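(* Let $(M^n,g,\phi,\lambda)$ be a manifold with density with normal weighted ambient metric $\widetilde g=2\,du\,dv+g_u$, $\widetilde\phi=\phi_u-v+\lambda uv$, and let $k\ge1$. There exist linear combinations $\mathcal Q$ and $\mathcal S$ of partial contractions (with respect to the metric) of tensor products of $Y_\phi$, $P_\phi$ and the tensors $(\Omega_\phi)^{(l)}_{ij}$ such that, at $u=0$, $$\partial_u^kg_{ij}=\mathcal Q\big(P_\phi,(\Omega_\phi)^{(1)}_{ij},\dots,(\Omega_\phi)^{(k-1)}_{ij}\big),\qquad \partial_u^k\phi=\mathcal S\big(Y_\phi,P_\phi,(\Omega_\phi)^{(1)}_{ij},\dots,(\Omega_\phi)^{(k-1)}_{ij}\big).$$ Similarly, there exist linear combinations $\mathcal T$ and $\mathcal V_k$ of complete contractions of tensor products of $Y_\phi$, $P_\phi$ and the $(\Omega_\phi)^{(l)}$ such that, at $u=0$, $$\tfrac12g^{ij}\partial_u^kg_{ij}-\partial_u^k\phi=\mathcal T\big(Y_\phi,P_\phi,(\Omega_\phi)^{(1)}_{ij},\dots,(\Omega_\phi)^{(k-2)}_{ij}\big),\qquad v_{k,\phi}=\mathcal V_k\big(Y_\phi,P_\phi,(\Omega_\phi)^{(1)},\dots,(\Omega_\phi)^{(k-2)}\big).$$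
   Context: For a (pseudo-)Riemannian manifold of dimension $m$ with function $\phi$ and $\lambda\in\mathbb R$: $P_\phi=\mathrm{Ric}+\nabla^2\phi-\lambda g$, $F_\phi=\Delta\phi-|\nabla\phi|^2+2\lambda\phi-m\lambda$, $Y_\phi=-\frac12[R+|\nabla\phi|^2-2\lambda\phi]$. The normal weighted ambient metric of $(M^n,g,\phi,\lambda)$ is the structure $\widetilde g=2\,du\,dv+g_u$, $\widetilde\phi=\phi_u-v+\lambda uv$ near $u=0$ in $\mathbb R_v\times M\times\mathbb R_u$, with $(g_u,\phi_u)$ a smooth family with $(g_0,\phi_0)=(g,\phi)$, such that $\widetilde P_\phi=O(u^\infty)$, $\widetilde F_\phi=O(u^\infty)$ at $u=0$ (tildes: quantities of $(\widetilde g,\widetilde\phi,\lambda)$, $m=n+2$); it is determined modulo $O(u^\infty)$. In $\partial_u^kg_{ij}$, $\partial_u^k\phi$ the symbols $g,\phi$ mean $g_u,\phi_u$. The index $\infty$ refers to the coordinate $u$, and $i,j$ to coordinates on $M$. For $k\ge1$, $(\Omega_\phi)^{(k)}_{ij}:=\widetilde R_{\infty ij\infty,\infty\cdots\infty}|_{u=0}$ with $k-1$ covariant-derivative indices $\infty$, where $\widetilde R$ is the curvature tensor of $\widetilde g$, with sign convention such that $\widetilde R_{\infty ij\infty}=\frac12\left[g''_{ij}-\frac12g^{kl}g'_{ki}g'_{lj}\right]$ ($'=\partial_u$). Lists $(\Omega_\phi)^{(1)},\dots,(\Omega_\phi)^{(r)}$ with $r\le0$ are empty. $v_\phi=\frac{e^{-\widetilde\phi}}{e^{-\phi}}\left(\frac{\det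 g_u}{\det g}\right)^{1/2}$ and $v_{k,\phi}=\frac1{k!}\partial_u^kv_\phi|_{u,v=0}$. *)

(* Defs.v *)
From HB Require Import structures.
From mathcomp Require Import all_boot all_order all_algebra.
From mathcomp Require Import all_classical all_reals all_analysis.

Set Implicit Arguments.
Unset Strict Implicit.
Unset Printing Implicit Defensive.

Import Order.TTheory GRing.Theory Num.Theory numFieldNormedType.Exports.

Local Open Scope classical_set_scope.
Local Open Scope ring_scope.

Section SmoothFunctions.
Variables (R : realType) (m : nat).
Implicit Types (f : 'rV[R]_m -> R) (D : set 'rV[R]_m).

Definition partial (i : 'I_m) f : 'rV[R]_m -> R :=
  fun x => 'D_(delta_mx 0 i) f x.

Definition iter_partial (s : seq 'I_m) f : 'rV[R]_m -> R := foldr partial f s.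

(* C^oo on D, for D open *)
Definition smooth_on D f : Prop :=
  forall x, D x -> forall s : seq 'I_m,
    {for x, continuous (iter_partial s f)} /\
    forall i, derivable (iter_partial s f) x (delta_mx 0 i).

End SmoothFunctions.

(* Pseudo-Riemannian geometry of a metric G on (an open subset of) R^m,
   with a function f and a constant lam, in the given coordinates. *)
Section CoordinateGeometry.
Variables (R : realType) (m : nat).
Variables (G : 'rV[R]_m -> 'M[R]_m) (f : 'rV[R]_m -> R) (lam : R).
Implicit Types (x : 'rV[R]_m) (i j k l p : 'I_m).

Definition christoffel k i j x : R :=
  2^-1 * \sum_l invmx (G x) k l *
    (partial i (fun y => G y j l) x + partial j (fun y => G y i l) x
     - partial l (fun y => G y i j) x).

(* R(d_i, d_j) d_k = \sum_l curvature_op l i j k d_l, where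
   R(X, Y) = [nabla_X, nabla_Y] - nabla_[X, Y] *)
Definition curvature_op l i j k x : R :=
  partial i (christoffel l j k) x - partial j (christoffel l i k) x
  + \sum_p (christoffel l i p x * christoffel p j k x
            - christoffel l j p x * christoffel p i k x).

(* R_ijkl = g (R(d_i, d_j) d_l, d_k), so that Ric_jl = g^ik R_ijkl is positive
   on round spheres and, for 2 du dv + g_u,
   R_{oo i j oo} = 1/2 (g''_ij - 1/2 g^kl g'_ki g'_lj) *)
Definition riemann i j k l x : R := \sum_p G x k p * curvature_op p i j l x.

Definition ricci j l x : R :=
  \sum_i \sum_k invmx (G x) i k * riemann i j k l x.

Definition scalar_curvature x : R :=
  \sum_i \sum_j invmx (G x) i j * ricci i j x.

Definition hessian i j x : R :=
  partial i (partial j f) x - \sum_k christoffel k i j x * partial k f x.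

Definition laplacian x : R := \sum_i \sum_j invmx (G x) i j * hessian i j x.

Definition grad_sqnorm x : R :=
  \sum_i \sum_j invmx (G x) i j * partial i f x * partial j f x.

Definition P_phi i j x : R := ricci i j x + hessian i j x - lam * G x i j.

Definition F_phi x : R :=
  laplacian x - grad_sqnorm x + 2 * lam * f x - m%:R * lam.

Definition Y_phi x : R :=
  - 2^-1 * (scalar_curvature x + grad_sqnorm x - 2 * lam * f x).

(* Components T_s of a covariant tensor field, s being the list of indices
   (only the lists of length the rank of T are meaningful) *)
Definition tensor_field := seq 'I_m -> 'rV[R]_m -> R.

Definition riemann_tensor : tensor_field := fun s x =>
  if s is [:: i; j; k; l] then riemann i j k l x else 0.

(* The index of the new derivative is put in front:
   T_{s,b} is covariant_derivative T (b :: s). *)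
Definition covariant_derivative (T : tensor_field) : tensor_field := fun s x =>
  if s is b :: t then
    partial b (T t) x
    - \sum_(p < size t) \sum_c christoffel c b (nth b t p) x
                               * T (set_nth b t p c) x
  else 0.

End CoordinateGeometry.

Section Manifolds.
Variables (R : realType) (n : nat).

Record chart (M : topologicalType) := Chart {
  dom : set M;
  img : set 'rV[R]_n;
  to_coord : M -> 'rV[R]_n;
  of_coord : 'rV[R]_n -> M;
  dom_open : open dom;
  img_open : open img;
  to_coord_img : forall p, dom p -> img (to_coord p);
  of_coord_dom : forall x, img x -> dom (of_coord x);
  to_coordK : forall p, dom p -> of_coord (to_coord p) = p;
  of_coordK : forall x, img x -> to_coord (of_coord x) = x;
  to_coord_continuous : forall p, dom p -> {for p, continuous to_coord};
  of_coord_continuous : forall x, img x -> {for x, continuous of_coord}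
}.

Definition transition (M : topologicalType) (c d : chart M) (i : 'I_n)
    (x : 'rV[R]_n) : R := to_coord d (of_coord c x) 0 i.

Definition overlap (M : topologicalType) (c d : chart M) : set 'rV[R]_n :=
  [set x | img c x /\ dom d (of_coord c x)].

Record manifold := Manifold {
  msort :> topologicalType;
  atlas : set (chart msort);
  manifold_hausdorff : hausdorff_space msort;
  manifold_second_countable : @second_countable msort;
  atlas_cover : forall p : msort, exists2 c, atlas c & dom c p;
  atlas_smooth : forall c d, atlas c -> atlas d ->
    forall i, smooth_on (overlap c d) (transition c d i)
}.

Definition jacobian (M : topologicalType) (c d : chart M) (x : 'rV[R]_n)
    : 'M[R]_n := \matrix_(i, j) partial i (transition c d j) x.

Definition smooth_function (M : manifold) (phi : M -> R) : Prop :=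
  forall c : chart M, atlas c -> smooth_on (img c) (fun x => phi (of_coord c x)).

(* A covariant 2-tensor field on M, given by its components in each chart *)
Definition tensor2 (M : manifold) := chart M -> 'rV[R]_n -> 'M[R]_n.

(* Components of a pseudo-Riemannian metric on the open set U at the
   points of U: symmetric, nondegenerate, correctly transforming *)
Definition metric_components (M : manifold) (U : set M) (g : tensor2 M)
    : Prop :=
  forall c : chart M, atlas c -> forall x, img c x -> U (of_coord c x) ->
  [/\ (g c x)^T = g c x,
      g c x \in unitmx
    & forall d, atlas d -> dom d (of_coord c x) ->
      g c x = jacobian c d x *m g d (to_coord d (of_coord c x))
                *m (jacobian c d x)^T].

Definition pseudo_riemannian (M : manifold) (g : tensor2 M) : Prop :=
  metric_components setT g /\
  forall c : chart M, atlas c -> forall i j, smooth_on (img c) (fun x => g c x i j).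

End Manifolds.

Arguments chart {R} n M.
Arguments atlas {R n} M c : rename.
Arguments overlap {R n M} c d.
Arguments transition {R n M} c d i x.
Arguments jacobian {R n M} c d x.

(* A point z of R_v x R^n x R_u has coordinates (v, (x, u)). *)
Section AmbientCoordinates.
Variables (R : realType) (n : nat).
Implicit Types z : 'rV[R]_(1 + (n + 1)).

Definition amb_v z : R := lsubmx z 0 0.
Definition amb_x z : 'rV[R]_n := lsubmx (rsubmx z).
Definition amb_u z : R := rsubmx (rsubmx z) 0 0.

Definition amb_point (v : R) (x : 'rV[R]_n) (u : R) : 'rV[R]_(1 + (n + 1)) :=
  row_mx v%:M (row_mx x u%:M).

Definition idx_x (i : 'I_n) : 'I_(1 + (n + 1)) := rshift 1 (lshift 1 i).
Definition idx_oo : 'I_(1 + (n + 1)) := rshift 1 (rshift n ord0).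

(* f = O(u^oo) near z0, z0 being a point of {u = 0} *)
Definition O_u_infty (f : 'rV[R]_(1 + (n + 1)) -> R)
    (z0 : 'rV[R]_(1 + (n + 1))) : Prop :=
  forall N : nat,
    ((f : _ -> R^o) =O_ (nbhs z0) ((fun z => amb_u z ^+ N) : _ -> R^o)).

End AmbientCoordinates.

Section AmbientMetric.
Variables (R : realType) (n : nat) (M : manifold R n).
Variables (g : tensor2 M) (phi : M -> R) (lam : R).
Variables (gu : R -> tensor2 M) (phiu : R -> M -> R).

(* 2 du dv + g_u *)
Definition amb_metric (c : chart n M) (z : 'rV[R]_(1 + (n + 1)))
    : 'M[R]_(1 + (n + 1)) :=
  block_mx 0                                 (row_mx 0 1%:M)
           (col_mx 0 1%:M)   (block_mx (gu (amb_u z) c (amb_x z)) 0 0 0).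

Definition amb_phi (c : chart n M) (z : 'rV[R]_(1 + (n + 1))) : R :=
  phiu (amb_u z) (of_coord c (amb_x z)) - amb_v z + lam * amb_u z * amb_v z.

(* The family (g_u, phi_u) is defined on a neighbourhood W of M x {0} in
   M x R; its smoothness is joint smoothness in (x, u). *)
Definition normal_weighted_ambient : Prop :=
  exists W : set (M * R)%type,
  [/\ open W /\ (forall p, W (p, 0)),
      forall u, metric_components [set p | W (p, u)] (gu u),
      (forall c : chart n M, atlas M c ->
        let D := [set y : 'rV[R]_(n + 1) | img c (lsubmx y) /\
                   W (of_coord c (lsubmx y), rsubmx y 0 0)] in
        (forall i j,
           smooth_on D (fun y => gu (rsubmx y 0 0) c (lsubmx y) i j)) /\
        smooth_on D (fun y => phiu (rsubmx y 0 0) (of_coord c (lsubmx y)))),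
      (forall c : chart n M, atlas M c -> forall x, img c x -> gu 0 c x = g c x) /\
      (forall p, phiu 0 p = phi p)
    & forall c : chart n M, atlas M c -> forall v x, img c x ->
      (forall a b, O_u_infty (P_phi (amb_metric c) (amb_phi c) lam a b)
                     (amb_point v x 0)) /\
      O_u_infty (F_phi (amb_metric c) (amb_phi c) lam) (amb_point v x 0)].

(* (Omega_phi)^(l) for l >= 1; the ambient curvature does not depend on v,
   so it is evaluated at v = 0. *)
Definition Omega_phi (c : chart n M) (l : nat) (x : 'rV[R]_n) : 'M[R]_n :=
  \matrix_(i, j)
    iter l.-1 (covariant_derivative (amb_metric c))
      (riemann_tensor (amb_metric c))
      (nseq l.-1 (idx_oo n) ++ [:: idx_oo n; idx_x i; idx_x j; idx_oo n])
      (amb_point 0 x 0).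

Definition v_phi (c : chart n M) (z : 'rV[R]_(1 + (n + 1))) : R :=
  expR (- amb_phi c z) / expR (- phi (of_coord c (amb_x z))) *
  Num.sqrt (\det (gu (amb_u z) c (amb_x z)) / \det (g c (amb_x z))).

Definition v_coef (k : nat) (c : chart n M) (x : 'rV[R]_n) : R :=
  (k`!%:R)^-1 * derive1n k (fun u => v_phi c (amb_point 0 x u)) 0.

End AmbientMetric.

Inductive symbol := SymP | SymOmega of nat.

(* A formal partial contraction, with nfree free indices, of the tensor product
   of nY copies of the scalar Y_phi and of the 2-tensors sym 0, ..., sym
   (nfac - 1).  The index slots of the s-th 2-tensor are (s, false) and
   (s, true); each slot is either free or paired with exactly one other slot,
   the pairs being contracted with the inverse metric. *)
Record contraction (nfree : nat) := Contraction {
  nY : nat;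
  nfac : nat;
  sym : 'I_nfac -> symbol;
  free_slots : nfree.-tuple ('I_nfac * bool)%type;
  pairs : seq (('I_nfac * bool) * ('I_nfac * bool))%type;
  slots_wf : perm_eq (free_slots ++ flatten [seq [:: pq.1; pq.2] | pq <- pairs])
                     (enum {: 'I_nfac * bool})
}.
Arguments nY {nfree} c.
Arguments nfac {nfree} c.
Arguments sym {nfree} c s.
Arguments free_slots {nfree} c.
Arguments pairs {nfree} c.

Definition lin_comb (R : realType) (nfree : nat) := seq (R * contraction nfree).

(* The tensor product is nonempty, only involves P_phi, (Omega_phi)^(l) with
   1 <= l <= K and, if withY holds, Y_phi. *)
Definition involves_only (withY : bool) (K : nat) (nfree : nat)
    (C : contraction nfree) : bool :=
  [&& (0 < nY C + nfac C)%N, withY || (nY C == 0%N) &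
      [forall s, if sym C s is SymOmega l then (0 < l <= K)%N else true]].

Definition lin_comb_in (R : realType) (withY : bool) (K : nat) (nfree : nat)
    (L : lin_comb R nfree) : bool := all (fun t => involves_only withY K t.2) L.

Section Evaluation.
Variables (R : realType) (n : nat).
(* ginv is the inverse metric *)
Variables (ginv : 'M[R]_n) (Y : R) (P : 'M[R]_n) (Omega : nat -> 'M[R]_n).

Definition eval_symbol (s : symbol) : 'M[R]_n :=
  match s with SymP => P | SymOmega l => Omega l end.

Definition eval_contraction nfree (C : contraction nfree)
    (idx : nfree.-tuple 'I_n) : R :=
  Y ^+ nY C *
  \sum_(a : {ffun 'I_(nfac C) * bool -> 'I_n} |
          [forall q, a (tnth (free_slots C) q) == tnth idx q])
     (\prod_s eval_symbol (sym C s) (a (s, false)) (a (s, true))) *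
     (\prod_(pq <- pairs C) ginv (a pq.1) (a pq.2)).

Definition eval_lin_comb nfree (L : lin_comb R nfree) (idx : nfree.-tuple 'I_n)
    : R := \sum_(t <- L) t.1 * eval_contraction t.2 idx.

End Evaluation.

(* The value, at the point of coordinates x in the chart c, of a linear
   combination of partial contractions for (M, g, phi, lam) *)
Definition lin_comb_at (R : realType) (n : nat) (M : manifold R n)
    (g : tensor2 M) (phi : M -> R) (lam : R) (gu : R -> tensor2 M)
    (c : chart n M) (x : 'rV[R]_n) (nfree : nat) (L : lin_comb R nfree)
    (idx : nfree.-tuple 'I_n) : R :=
  let f := fun y => phi (of_coord c y) in
  eval_lin_comb (invmx (g c x)) (Y_phi (g c) f lam x)
    (\matrix_(i, j) P_phi (g c) f lam i j x)
    (fun l => Omega_phi gu c l x) L idx.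

(* Main.v *)
Require Import Defs.
From mathcomp Require Import all_boot all_order all_algebra.
From mathcomp Require Import all_classical all_reals all_analysis.
From mathcomp Require Import perm ring.
Import Order.TTheory GRing.Theory Num.Theory numFieldNormedType.Exports.
Local Open Scope classical_set_scope.
Local Open Scope ring_scope.

(* Let B = g^-1 g' / 2 along u, where ' = d/du, and let E_l = g^-1 Omega_l.  The
   Christoffel symbols of 2 du dv + g_u give E_1 = B' + B^2 and
   E_(l+1) = E_l' + [B, E_l], so that d/du acts on the noncommutative polynomials
   in B, E_1, E_2, ... as a derivation raising the index l by at most one, and
   g^(k) = g q_k for a recursively defined polynomial q_k.  The equations P~ = 0
   in the directions (i, j) and F~ = 0 give B = g^-1 P and phi' = - Y at u = 0;
   the equation in the direction (oo, oo) reads phi'' = tr E_1 + O(u^oo).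
   For f = log (det g)^(1/2) - phi this gives f' = tr B + Y at u = 0 and
   f'' = - tr B^2 + O(u^oo), where E_1 has cancelled: this is why tr g^-1 g^(k) / 2
   - phi^(k) and the Taylor coefficients of exp f only involve E_l for l <= k - 2.
   Finally, a product S_1 g^-1 S_2 g^-1 ... S_m and its trace against g^-1 are
   partial contractions of the tensors S_i. *)
Set Implicit Arguments.
Unset Strict Implicit.
Unset Printing Implicit Defensive.

(* mathcomp-analysis also has a [contraction]. *)
Local Notation contraction := Defs.contraction.
Local Notation "f ^` ()" := (derive1 f) : ring_scope.
Local Notation "f ^` ( n )" := (derive1n n f) : ring_scope.

(** * Contractions *)

Section Contractions.
Variables (R : realType) (n : nat).
Implicit Types (K : nat) (b : bool).

Notation slot m := ('I_m * bool)%type.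

(** The coefficients may not depend on the manifold, on lam or on the point, so jets are computed
    with formal expressions in B, E_1, E_2, ..., and matrices enter only by evaluation. One
    expression is read in two ways: with the matrix product on endomorphisms g^-1 S, where the
    differential equations live, and with the product X g^-1 Z on covariant tensors, where
    contractions live. Multiplication by g^-1 carries the second reading to the first. The constant
    lam enters only through P and Y.

    The identities for g and the E_l hold on a neighbourhood of u = 0 and can be differentiated
    there. The equation phi'' = tr E_1 holds only to infinite order at u = 0, so only its jet at 0
    is available: a smooth remainder that is O(u^N) for every N has all derivatives zero at 0, which
    follows from a one-sided Taylor estimate.

    For an indefinite metric det g may be negative. The function f is therefore never formed; only
    f' = tr B - phi' occurs, and the root is taken of the quotient det g_u / det g_0, which is
    positive near u = 0. *)

Definition lslot m1 m2 (q : slot m1) : slot (m1 + m2) := (lshift m2 q.1, q.2).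
Definition rslot m1 m2 (q : slot m2) : slot (m1 + m2) := (rshift m1 q.1, q.2).

Definition map_pairs (T T' : Type) (f : T -> T') (s : seq (T * T)) :=
  [seq (f pq.1, f pq.2) | pq <- s].

Lemma flatten_map_pairs (T T' : Type) (f : T -> T') (s : seq (T * T)) :
  flatten [seq [:: pq.1; pq.2] | pq <- map_pairs f s]
  = map f (flatten [seq [:: pq.1; pq.2] | pq <- s]).
Proof. by rewrite map_flatten -!map_comp. Qed.

Lemma lslot_inj m1 m2 : injective (@lslot m1 m2).
Proof. by move=> [i a] [j c] [] e1 e2; congr pair => //; apply: ord_inj. Qed.

Lemma rslot_inj m1 m2 : injective (@rslot m1 m2).
Proof.
move=> [i a] [j c] [] e1 e2; congr pair => //; apply: ord_inj.
by apply/eqP; rewrite -(eqn_add2l m1); apply/eqP.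
Qed.

Lemma perm_slots m1 m2 :
  perm_eq (map (@lslot m1 m2) (enum {: slot m1})
           ++ map (@rslot m1 m2) (enum {: slot m2}))
          (enum {: slot (m1 + m2)}).
Proof.
apply: uniq_perm; rewrite ?enum_uniq //.
  rewrite cat_uniq (map_inj_uniq (@lslot_inj _ _)) (map_inj_uniq (@rslot_inj _ _)).
  rewrite !enum_uniq andbT /=.
  apply/hasPn => _ /mapP[[i a] _ ->]; apply/negP => /mapP[[j c] _] [] e _.
  by have := ltn_ord j; rewrite -e ltnNge leq_addr.
move=> [i a]; rewrite mem_cat [RHS]mem_enum /=.
case: (split_ordP i) => j ->; apply/orP; [left|right].
  by apply/mapP; exists (j, a); rewrite ?mem_enum.
by apply/mapP; exists (j, a); rewrite ?mem_enum.
Qed.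

Definition glue_sym nf1 nf2 (C1 : contraction nf1) (C2 : contraction nf2)
    (s : 'I_(nfac C1 + nfac C2)) : symbol :=
  match fintype.split s with inl s1 => sym C1 s1 | inr s2 => sym C2 s2 end.

Definition glue_pairs nf1 nf2 (C1 : contraction nf1) (C2 : contraction nf2) :=
  map_pairs (@lslot (nfac C1) (nfac C2)) (pairs C1)
  ++ map_pairs (@rslot (nfac C1) (nfac C2)) (pairs C2).

Lemma glue_wf nf1 nf2 nf (C1 : contraction nf1) (C2 : contraction nf2)
    (fs : nf.-tuple (slot (nfac C1 + nfac C2))) ps :
  perm_eq (fs ++ flatten [seq [:: pq.1; pq.2] | pq <- ps])
    (map (@lslot _ _) (free_slots C1) ++ map (@rslot _ _) (free_slots C2)) ->
  perm_eq (fs ++ flatten [seq [:: pq.1; pq.2] | pq <- ps ++ glue_pairs C1 C2])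
          (enum {: slot (nfac C1 + nfac C2)}).
Proof.
move=> H; rewrite !map_cat !flatten_cat catA.
apply: (perm_trans _ (perm_slots _ _)).
have:= perm_map (@lslot (nfac C1) (nfac C2)) (slots_wf C1).
have:= perm_map (@rslot (nfac C1) (nfac C2)) (slots_wf C2).
rewrite perm_sym => H2; rewrite perm_sym => H1.
rewrite perm_sym; apply: perm_trans (perm_cat H1 H2) _.
rewrite !map_cat !flatten_map_pairs.
apply: perm_trans (perm_cat _ (perm_refl _)); last by rewrite perm_sym; exact: H.
by rewrite -!catA perm_cat2l perm_catCA.
Qed.

(** The tensor product of two contractions, followed by contraction of some of the formerly free
    slots. The hypothesis [H] says that the new free slots [fs] and the new pairs [ps] together use
    each former free slot exactly once. Products of scalars and products through g^-1 are both
    instances. *)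
Definition glue nf1 nf2 nf (C1 : contraction nf1) (C2 : contraction nf2)
    (fs : nf.-tuple (slot (nfac C1 + nfac C2))) ps H : contraction nf :=
  @Contraction nf (nY C1 + nY C2) (nfac C1 + nfac C2) (glue_sym (C2 := C2)) fs
    (ps ++ glue_pairs C1 C2) (glue_wf (ps := ps) H).

Lemma glue_involves b K nf1 nf2 nf (C1 : contraction nf1) (C2 : contraction nf2)
    (fs : nf.-tuple (slot (nfac C1 + nfac C2))) ps H :
  involves_only b K C1 -> involves_only b K C2 ->
  involves_only b K (@glue _ _ nf C1 C2 fs ps H).
Proof.
move=> /and3P[p1 y1 /forallP s1] /and3P[p2 y2 /forallP s2].
apply/and3P; split => /=.
- by apply: leq_trans p1 _; rewrite leq_add ?leq_addr.
- by case: b y1 y2 => //= /eqP-> /eqP->.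
- by apply/forallP => s; rewrite /glue_sym; case: (fintype.split s) => t; [exact: s1|exact: s2].
Qed.

(** * Evaluation of a glued contraction *)

Section Evaluate.
Variables (ginv : 'M[R]_n) (Y : R) (P : 'M[R]_n) (Omega : nat -> 'M[R]_n).
Notation evC := (eval_contraction ginv Y P Omega).
Notation evS := (eval_symbol P Omega).

Definition weight nf (C : contraction nf) (a : slot (nfac C) -> 'I_n) : R :=
  (\prod_s evS (sym C s) (a (s, false)) (a (s, true))) *
  (\prod_(pq <- pairs C) ginv (a pq.1) (a pq.2)).
Arguments weight {nf} C a.

Lemma eval_weight nf (C : contraction nf) idx :
  evC C idx = Y ^+ nY C *
    \sum_(a : {ffun slot (nfac C) -> 'I_n} |
            [forall q, a (tnth (free_slots C) q) == tnth idx q]) weight C a.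
Proof. by []. Qed.

Lemma weight_ext nf (C : contraction nf) a a' : a =1 a' -> weight C a = weight C a'.
Proof. by move=> e; congr (_ * _); apply: eq_bigr => *; rewrite !e. Qed.

Lemma weight_glue nf1 nf2 nf (C1 : contraction nf1) (C2 : contraction nf2)
    (fs : nf.-tuple (slot (nfac C1 + nfac C2))) ps H a :
  weight (@glue _ _ nf C1 C2 fs ps H) a
  = (\prod_(pq <- ps) ginv (a pq.1) (a pq.2)) *
    (weight C1 (a \o @lslot _ _) * weight C2 (a \o @rslot _ _)).
Proof.
rewrite /weight /= big_split_ord /= !big_cat /= !big_map.
rewrite mulrCA [in RHS]mulrACA; congr (_ * (_ * _ * _)); apply: eq_bigr => s _.
  by rewrite /glue_sym -[lshift _ _]/(unsplit (inl s)) unsplitK.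
by rewrite /glue_sym -[rshift _ _]/(unsplit (inr s)) unsplitK.
Qed.

Definition join_ffun m1 m2 (a : {ffun slot m1 -> 'I_n} * {ffun slot m2 -> 'I_n})
    : {ffun slot (m1 + m2) -> 'I_n} :=
  [ffun q => match fintype.split q.1 with inl s => a.1 (s, q.2) | inr s => a.2 (s, q.2) end].

Lemma join_ffunl m1 m2 a (q : slot m1) : join_ffun a (lslot m2 q) = a.1 q.
Proof.
by case: q => i b; rewrite ffunE /= -[lshift _ _]/(unsplit (inl i)) unsplitK.
Qed.

Lemma join_ffunr m1 m2 a (q : slot m2) : join_ffun a (rslot m1 q) = a.2 q.
Proof.
by case: q => i b; rewrite ffunE /= -[rshift _ _]/(unsplit (inr i)) unsplitK.
Qed.

(** An index assignment on the slots of the product is a pair of assignments. The two are coupled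
    only by the new pairs [ps] and by the condition on [fs]. *)
Lemma eval_glue nf1 nf2 nf (C1 : contraction nf1) (C2 : contraction nf2)
    (fs : nf.-tuple (slot (nfac C1 + nfac C2))) ps H idx :
  evC (@glue _ _ nf C1 C2 fs ps H) idx =
  Y ^+ nY C1 * Y ^+ nY C2 * \sum_(a1 : {ffun slot (nfac C1) -> 'I_n})
    \sum_(a2 : {ffun slot (nfac C2) -> 'I_n} |
       [forall q, join_ffun (a1, a2) (tnth fs q) == tnth idx q])
    (\prod_(pq <- ps) ginv (join_ffun (a1, a2) pq.1) (join_ffun (a1, a2) pq.2)) *
    (weight C1 a1 * weight C2 a2).
Proof.
rewrite eval_weight -exprD; congr (_ * _).
rewrite pair_big_dep /= (reindex (@join_ffun (nfac C1) (nfac C2))) /=; last first.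
  exists (fun a => ([ffun q => a (lslot _ q)], [ffun q => a (rslot _ q)])).
    move=> [a1 a2] _; congr pair; apply/ffunP => q; rewrite ffunE.
      by rewrite join_ffunl.
    by rewrite join_ffunr.
  move=> a _; apply/ffunP => -[i b]; rewrite ffunE.
  by case: (split_ordP i) => j ->; rewrite /= ffunE.
apply: eq_big => [[a1 a2]//|[a1 a2] _]; rewrite weight_glue.
congr (_ * (_ * _)); apply: weight_ext => q /=.
  by rewrite join_ffunl.
by rewrite join_ffunr.
Qed.

End Evaluate.
Arguments weight ginv P Omega {nf} C a.

(** * Products, traces and elementary contractions *)

Definition mul0_free (C1 C2 : contraction 0) : 0.-tuple (slot (nfac C1 + nfac C2)) :=
  [tuple].

Lemma mul0_wf C1 C2 :
  perm_eq (mul0_free C1 C2 ++ flatten [seq [:: pq.1; pq.2] | pq <- [::]])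
    (map (@lslot _ _) (free_slots C1) ++ map (@rslot _ _) (free_slots C2)).
Proof.
have free0 (C : contraction 0) : tval (free_slots C) = [::].
  by case: (free_slots C) => -[].
by rewrite !free0.
Qed.

Definition mul0 C1 C2 := glue (@mul0_wf C1 C2).

Lemma eval_mul0 ginv Y P Om C1 C2 :
  eval_contraction (R:=R) (n:=n) ginv Y P Om (mul0 C1 C2) [tuple] =
  eval_contraction ginv Y P Om C1 [tuple] * eval_contraction ginv Y P Om C2 [tuple].
Proof.
have all0 (T : finType) (C : 'I_0 -> T -> bool) (F : T -> R) :
    \sum_(a | [forall q, C q a]) F a = \sum_a F a.
  by apply: eq_bigl => a; apply/forallP => -[].
rewrite eval_glue !eval_weight mulrACA; congr (_ * _).
rewrite !all0 big_distrlr /=; apply: eq_bigr => a1 _.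
by rewrite all0; apply: eq_bigr => a2 _; rewrite big_nil mul1r.
Qed.

Notation fslot C i := (tnth (free_slots C) i).

Definition mul2_free (C1 C2 : contraction 2) : 2.-tuple (slot (nfac C1 + nfac C2)) :=
  [tuple lslot _ (fslot C1 ord0); rslot _ (fslot C2 ord_max)].

Definition mul2_pairs (C1 C2 : contraction 2) :=
  [:: (lslot (nfac C2) (fslot C1 ord_max), rslot (nfac C1) (fslot C2 ord0))].

Lemma tuple2E (T : Type) (t : 2.-tuple T) : tval t = [:: tnth t ord0; tnth t ord_max].
Proof. by case/tupleP: t => a t; case/tupleP: t => b t; rewrite (tuple0 t). Qed.

Lemma free2 (C : contraction 2) :
  tval (free_slots C) = [:: fslot C ord0; fslot C ord_max].
Proof. exact: tuple2E. Qed.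

Lemma mul2_wf C1 C2 :
  perm_eq (mul2_free C1 C2 ++ flatten [seq [:: pq.1; pq.2] | pq <- mul2_pairs C1 C2])
    (map (@lslot _ _) (free_slots C1) ++ map (@rslot _ _) (free_slots C2)).
Proof.
rewrite !free2 /= perm_cons.
by apply/seq.permP => p /=; rewrite addnCA; congr (_ + _)%N; rewrite addnCA.
Qed.

Definition mul2 C1 C2 := glue (@mul2_wf C1 C2).

Lemma forall_ord2 (p : pred 'I_2) : [forall q, p q] = p ord0 && p ord_max.
Proof.
apply/forallP/andP => [H|[p0 p1] q]; first by split; exact: H.
by case: (unliftP ord_max q) => [j|] -> //; rewrite ord1 (_ : lift _ _ = ord0) //; exact/val_inj.
Qed.

(** Assignments are grouped by the value of [h], the index at a slot that is to be contracted. This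
    turns a sum over assignments into an explicit sum over that index. *)
Lemma fiber_sum (T : finType) (A : pred T) (h : T -> 'I_n) (W : T -> R) F :
  \sum_p (\sum_(a | A a && (h a == p)) W a) * F p = \sum_(a | A a) W a * F (h a).
Proof.
rewrite [RHS](partition_big h predT) //=; apply: eq_bigr => p _.
by rewrite big_distrl /=; apply: eq_bigr => a /andP[_ /eqP->].
Qed.

(** Two applications of [fiber_sum], one for each end of the new pair, produce the sums over p and
    q. *)
Lemma eval_mul2 ginv Y P Om C1 C2 i j :
  eval_contraction (R:=R) (n:=n) ginv Y P Om (mul2 C1 C2) [tuple i; j] =
  \sum_p \sum_q eval_contraction ginv Y P Om C1 [tuple i; p] * ginv p q *
                eval_contraction ginv Y P Om C2 [tuple q; j].
Proof.
rewrite eval_glue /=.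
transitivity (Y ^+ nY C1 * Y ^+ nY C2 *
   \sum_(a1 : {ffun slot (nfac C1) -> 'I_n} | a1 (fslot C1 ord0) == i)
   weight ginv P Om C1 a1 *
   \sum_(a2 : {ffun slot (nfac C2) -> 'I_n} | a2 (fslot C2 ord_max) == j)
   weight ginv P Om C2 a2 * ginv (a1 (fslot C1 ord_max)) (a2 (fslot C2 ord0))).
  congr (_ * _); rewrite [RHS]big_mkcond /=; apply: eq_bigr => a1 _.
  under eq_bigl => a2 do rewrite forall_ord2 /= join_ffunl join_ffunr /=.
  case: eqP => _ /=; last by rewrite big_pred0.
  rewrite mulr_sumr; apply: eq_bigr => a2 _.
  by rewrite big_seq1 /= join_ffunl join_ffunr mulrC -mulrA.
have E C k l : eval_contraction ginv Y P Om C [tuple k; l] = Y ^+ nY C *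
    \sum_(a : {ffun slot (nfac C) -> 'I_n} |
       (a (fslot C ord0) == k) && (a (fslot C ord_max) == l)) weight ginv P Om C a.
  by congr (_ * _); apply: eq_bigl => a; rewrite forall_ord2.
rewrite -mulrA -(fiber_sum (fun a : {ffun _} => a (fslot C1 ord0) == i)
  (fun a : {ffun _} => a (fslot C1 ord_max)) (weight ginv P Om C1)
  (fun p => \sum_(a2 : {ffun slot (nfac C2) -> 'I_n} | a2 (fslot C2 ord_max) == j)
     weight ginv P Om C2 a2 * ginv p (a2 (fslot C2 ord0)))).
rewrite mulr_sumr mulr_sumr; apply: eq_bigr => p _.
rewrite mulrCA [X in _ * X]mulrA -E mulrCA.
under [RHS]eq_bigr => q _ do rewrite -mulrA.
rewrite -mulr_sumr; congr (_ * _).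
rewrite -(fiber_sum (fun a : {ffun _} => a (fslot C2 ord_max) == j)
  (fun a : {ffun _} => a (fslot C2 ord0)) (weight ginv P Om C2) (ginv p)).
rewrite mulr_sumr; apply: eq_bigr => q _.
by rewrite mulrA [RHS]mulrC E; congr (_ * _ * _); apply: eq_bigl => a; rewrite andbC.
Qed.

(** The new pair runs from the second free slot to the first. [ginv] is an arbitrary matrix, not
    assumed symmetric, and this order is the one that gives the trace of g^-1 X. *)
Lemma trace2_wf (C : contraction 2) :
  perm_eq ([tuple] ++ flatten [seq [:: pq.1; pq.2] |
             pq <- (fslot C ord_max, fslot C ord0) :: pairs C])
          (enum {: slot (nfac C)}).
Proof.
apply: perm_trans (slots_wf C); rewrite free2 /=.
by apply/seq.permP => p /=; rewrite addnCA.
Qed.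

Definition trace2 (C : contraction 2) : contraction 0 :=
  Contraction (nY C) (sym C) (trace2_wf C).

Lemma eval_trace2 ginv Y P Om C :
  eval_contraction (R:=R) (n:=n) ginv Y P Om (trace2 C) [tuple] =
  \sum_i \sum_j ginv j i * eval_contraction ginv Y P Om C [tuple i; j].
Proof.
have E k l : eval_contraction ginv Y P Om C [tuple k; l] = Y ^+ nY C *
    \sum_(a : {ffun slot (nfac C) -> 'I_n} |
       (a (fslot C ord0) == k) && (a (fslot C ord_max) == l)) weight ginv P Om C a.
  by congr (_ * _); apply: eq_bigl => a; rewrite forall_ord2.
under eq_bigr => i _ do under eq_bigr => j _ do rewrite E mulrCA mulrC.
have Fs i : \sum_j ginv j i * (\sum_(a : {ffun slot (nfac C) -> 'I_n} |
       (a (fslot C ord0) == i) && (a (fslot C ord_max) == j)) weight ginv P Om C a) * Y ^+ nY C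
   = (\sum_(a : {ffun slot (nfac C) -> 'I_n} | a (fslot C ord0) == i)
      weight ginv P Om C a * ginv (a (fslot C ord_max)) i) * Y ^+ nY C.
  rewrite -(fiber_sum _ (fun a : {ffun _} => a (fslot C ord_max)) _ (fun j => ginv j i)) mulr_suml.
  by apply: eq_bigr => j _; rewrite (mulrC (ginv _ _)).
under eq_bigr => i _ do rewrite Fs.
rewrite -mulr_suml mulrC eval_weight /=; congr (_ * _).
rewrite (partition_big (fun a : {ffun _} => a (fslot C ord0)) predT) //=.
apply: eq_bigr => i _; apply: eq_big => [a|a /andP[_ /eqP <-]].
  by rewrite (_ : [forall q, _]) //; apply/forallP => -[].
by rewrite [in LHS]/weight big_cons /= mulrCA mulrC.
Qed.

Lemma single_wf : perm_eq ([tuple (ord0 : 'I_1, false); (ord0 : 'I_1, true)] ++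
    flatten [seq [:: pq.1; pq.2] | pq <- ([::] : seq (slot 1 * slot 1))])
    (enum {: slot 1}).
Proof.
apply: uniq_perm; rewrite ?enum_uniq // => -[i []]; rewrite mem_enum ord1 //.
Qed.

Definition single (s : symbol) : contraction 2 :=
  Contraction 0 (fun _ => s) single_wf.

Lemma eval_single ginv Y P Om s i j :
  eval_contraction (R:=R) (n:=n) ginv Y P Om (single s) [tuple i; j] =
  eval_symbol P Om s i j.
Proof.
rewrite eval_weight expr0 mul1r.
rewrite (big_pred1 [ffun q : slot 1 => if q.2 then j else i]) /=; last first.
  move=> a; rewrite forall_ord2 /=; apply/andP/eqP => [[/eqP ai /eqP aj]|->].
    by apply/ffunP => -[k []]; rewrite ord1 ffunE /=.
  by rewrite !ffunE.
by rewrite /weight big_ord1 big_nil mulr1 !ffunE.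
Qed.

Lemma scalarY_wf : perm_eq ([tuple] ++
    flatten [seq [:: pq.1; pq.2] | pq <- ([::] : seq (slot 0 * slot 0))])
    (enum {: slot 0}).
Proof. by apply: uniq_perm; rewrite ?enum_uniq // => -[[]]. Qed.

Definition scalarY : contraction 0 :=
  Contraction 1 (fun _ => SymP) scalarY_wf.

Lemma eval_scalarY ginv Y P Om :
  eval_contraction (R:=R) (n:=n) ginv Y P Om scalarY [tuple] = Y.
Proof.
rewrite eval_weight expr1 -[RHS]mulr1; congr (_ * _).
rewrite (eq_bigr (fun=> 1)) => [|a _]; last by rewrite /weight big_ord0 big_nil mulr1.
rewrite (eq_bigl predT) => [|a]; last by apply/forallP => -[].
by rewrite sumr_const cardT -cardE card_ffun card_prod !card_ord mul0n expn0.
Qed.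

(** A single formal combination must represent X for all matrices, with no symmetry or relation
    between them. This makes the coefficients universal and the closure properties purely algebraic.
    X has no argument Y because the combinations here contain no factor Y. *)
Definition tensor_invariant K
    (X : 'M[R]_n -> 'M[R]_n -> (nat -> 'M[R]_n) -> 'M[R]_n) : Prop :=
  exists2 L : lin_comb R 2, lin_comb_in false K L &
    forall ginv Y P Om i j,
      eval_lin_comb ginv Y P Om L [tuple i; j] = X ginv P Om i j.

Definition scalar_invariant K
    (f : 'M[R]_n -> R -> 'M[R]_n -> (nat -> 'M[R]_n) -> R) : Prop :=
  exists2 L : lin_comb R 0, lin_comb_in true K L &
    forall ginv Y P Om, eval_lin_comb ginv Y P Om L [tuple] = f ginv Y P Om.

Definition scale_comb nf (c : R) (L : lin_comb R nf) : lin_comb R nf :=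
  [seq (c * t.1, t.2) | t <- L].

Lemma scale_comb_in b K nf c (L : lin_comb R nf) :
  lin_comb_in b K L -> lin_comb_in b K (scale_comb c L).
Proof. by rewrite /lin_comb_in all_map. Qed.

Lemma eval_scale_comb ginv Y P Om nf c (L : lin_comb R nf) idx :
  eval_lin_comb (n := n) ginv Y P Om (scale_comb c L) idx
  = c * eval_lin_comb ginv Y P Om L idx.
Proof.
by rewrite /eval_lin_comb big_map mulr_sumr; apply: eq_bigr => t _; rewrite mulrA.
Qed.

Definition mul_comb nf1 nf2 nf
    (m : contraction nf1 -> contraction nf2 -> contraction nf)
    (L1 : lin_comb R nf1) (L2 : lin_comb R nf2) : lin_comb R nf :=
  [seq (t1.1 * t2.1, m t1.2 t2.2) | t1 <- L1, t2 <- L2].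

Lemma mul_comb_in b K nf1 nf2 nf (m : contraction nf1 -> contraction nf2 -> contraction nf)
    L1 L2 :
  (forall C1 C2, involves_only b K C1 -> involves_only b K C2 ->
     involves_only b K (m C1 C2)) ->
  lin_comb_in b K L1 -> lin_comb_in b K L2 -> lin_comb_in b K (mul_comb m L1 L2).
Proof.
rewrite /lin_comb_in => mP + H2; elim: L1 => //= t1 L1 IH /andP[t1P /IH].
rewrite all_cat all_map => ->; rewrite andbT.
by apply: sub_all H2 => t2 t2P /=; apply: mP.
Qed.

Lemma eval_mul_comb ginv Y P Om nf1 nf2 nf
    (m : contraction nf1 -> contraction nf2 -> contraction nf) L1 L2 idx :
  eval_lin_comb (n := n) ginv Y P Om (mul_comb m L1 L2) idx
  = \sum_(t1 <- L1) \sum_(t2 <- L2)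
      t1.1 * t2.1 * eval_contraction ginv Y P Om (m t1.2 t2.2) idx.
Proof. by rewrite /eval_lin_comb big_allpairs_dep. Qed.

Lemma lin_comb_in_add b K nf (L1 L2 : lin_comb R nf) :
  lin_comb_in b K L1 -> lin_comb_in b K L2 -> lin_comb_in b K (L1 ++ L2).
Proof. by rewrite /lin_comb_in all_cat => -> ->. Qed.

(** Besides raising the bound, this allows factors Y, which is what the passage from a tensor to its
    trace requires. *)
Lemma involves_only_le b K K' nf (C : contraction nf) : (K <= K')%N ->
  involves_only b K C -> involves_only true K' C.
Proof.
move=> KK' /and3P[pC _ /forallP sC]; apply/and3P; split=> //.
apply/forallP => s; move: (sC s); case: (sym C s) => // l /andP[-> /=].
by move/leq_trans; apply.
Qed.

Lemma tensor_invariant_single K s :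
  (if s is SymOmega l then (0 < l <= K)%N else true) ->
  tensor_invariant K (fun _ P Om => eval_symbol P Om s).
Proof.
move=> sK; exists [:: (1, single s)] => [|ginv Y P Om i j].
  by rewrite /lin_comb_in /= andbT; apply/forallP.
by rewrite /eval_lin_comb big_seq1 mul1r eval_single.
Qed.

Lemma tensor_invariantD K X1 X2 :
  tensor_invariant K X1 -> tensor_invariant K X2 ->
  tensor_invariant K (fun g P Om => X1 g P Om + X2 g P Om).
Proof.
move=> [L1 H1 e1] [L2 H2 e2]; exists (L1 ++ L2); first exact: lin_comb_in_add.
by move=> g Y *; rewrite mxE -(e1 g Y) -(e2 g Y) /eval_lin_comb big_cat.
Qed.

Lemma tensor_invariantZ K c X :
  tensor_invariant K X -> tensor_invariant K (fun g P Om => c *: X g P Om).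
Proof.
move=> [L H e]; exists (scale_comb c L); first exact: scale_comb_in.
by move=> g Y *; rewrite mxE -(e g Y) eval_scale_comb.
Qed.

Lemma tensor_invariantM K X1 X2 :
  tensor_invariant K X1 -> tensor_invariant K X2 ->
  tensor_invariant K (fun g P Om => X1 g P Om *m g *m X2 g P Om).
Proof.
move=> [L1 H1 e1] [L2 H2 e2]; exists (mul_comb mul2 L1 L2).
  by apply: mul_comb_in => // C1 C2; apply: glue_involves.
move=> ginv Y P Om i j; rewrite eval_mul_comb mxE.
transitivity (\sum_p \sum_q X1 ginv P Om i p * ginv p q * X2 ginv P Om q j).
  under eq_bigr => t1 _ do under eq_bigr => t2 _ do rewrite eval_mul2 mulr_sumr.
  under eq_bigr => t1 _ do rewrite exchange_big /=.
  rewrite exchange_big /=; apply: eq_bigr => p _.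
  under eq_bigr => t1 _ do under eq_bigr => t2 _ do rewrite mulr_sumr.
  under eq_bigr => t1 _ do rewrite exchange_big /=.
  rewrite exchange_big /=; apply: eq_bigr => q _.
  rewrite -(e1 ginv Y) -(e2 ginv Y) /eval_lin_comb !mulr_suml; apply: eq_bigr => t1 _.
  rewrite mulr_sumr; apply: eq_bigr => t2 _.
  by rewrite mulrACA !mulrA.
rewrite exchange_big /=; apply: eq_bigr => q _.
by rewrite mxE mulr_suml; apply: eq_bigr.
Qed.

Lemma scalar_invariant_le K K' f : (K <= K')%N ->
  scalar_invariant K f -> scalar_invariant K' f.
Proof.
move=> KK' [L H e]; exists L => //.
by apply: sub_all H => t; apply: involves_only_le.
Qed.

Lemma scalar_invariant_trace K X : tensor_invariant K X ->
  scalar_invariant K (fun g _ P Om => \tr (g *m X g P Om)).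
Proof.
move=> [L H e]; exists [seq (t.1, trace2 t.2) | t <- L].
  rewrite /lin_comb_in all_map; apply: sub_all H => t /=.
  by move/(involves_only_le (leqnn K)).
move=> ginv Y P Om; rewrite /eval_lin_comb big_map /= /mxtrace.
under eq_bigr => t _ do rewrite eval_trace2 mulr_sumr.
rewrite exchange_big /= .
under eq_bigr => i _ do under eq_bigr => t _ do rewrite mulr_sumr.
under eq_bigr => i _ do rewrite exchange_big /=.
rewrite exchange_big /=; apply: eq_bigr => j _; rewrite mxE.
apply: eq_bigr => i _; rewrite -(e ginv Y) /eval_lin_comb mulr_sumr.
by apply: eq_bigr => t _; rewrite mulrCA.
Qed.

Lemma scalar_invariantD K f1 f2 :
  scalar_invariant K f1 -> scalar_invariant K f2 ->
  scalar_invariant K (fun g Y P Om => f1 g Y P Om + f2 g Y P Om).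
Proof.
move=> [L1 H1 e1] [L2 H2 e2]; exists (L1 ++ L2); first exact: lin_comb_in_add.
by move=> *; rewrite -e1 -e2 /eval_lin_comb big_cat.
Qed.

Lemma scalar_invariantZ K c f :
  scalar_invariant K f -> scalar_invariant K (fun g Y P Om => c * f g Y P Om).
Proof.
move=> [L H e]; exists (scale_comb c L); first exact: scale_comb_in.
by move=> *; rewrite -e eval_scale_comb.
Qed.

Lemma scalar_invariantM K f1 f2 :
  scalar_invariant K f1 -> scalar_invariant K f2 ->
  scalar_invariant K (fun g Y P Om => f1 g Y P Om * f2 g Y P Om).
Proof.
move=> [L1 H1 e1] [L2 H2 e2]; exists (mul_comb mul0 L1 L2).
  by apply: mul_comb_in => // C1 C2; apply: glue_involves.
move=> ginv Y P Om; rewrite eval_mul_comb -e1 -e2 /eval_lin_comb mulr_suml.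
apply: eq_bigr => t1 _; rewrite mulr_sumr; apply: eq_bigr => t2 _.
by rewrite eval_mul0 mulrACA.
Qed.

Lemma scalar_invariantY K : scalar_invariant K (fun _ Y _ _ => Y).
Proof.
exists [:: (1, scalarY)] => [|ginv Y P Om].
  by rewrite /lin_comb_in /= andbT; apply/forallP => -[].
by rewrite /eval_lin_comb big_seq1 mul1r eval_scalarY.
Qed.

End Contractions.

(** * Noncommutative polynomials and formal derivations *)

Section Expressions.
Variable R : realType.

(* Noncommutative polynomials; [der d] is the derivation extending [d]. *)
Inductive exp :=
| Var of nat
| Add of exp & exp
| Scale of R & exp
| Mul of exp & exp.

(** The product is a parameter because three are needed: the matrix product, the product X g^-1 Z of
    covariant tensors, and multiplication of real numbers for the derivatives of the volume. *)
Fixpoint eval (V : lmodType R) (mul : V -> V -> V) (x : nat -> V) (e : exp) : V :=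
  match e with
  | Var l => x l
  | Add a b => eval mul x a + eval mul x b
  | Scale c a => c *: eval mul x a
  | Mul a b => mul (eval mul x a) (eval mul x b)
  end.

(** The largest index of a variable, whatever the degree. With [Var 0] standing for B or P and
    [Var l] for E_l or Omega_l, level at most K means that only Omega_1, ..., Omega_K can occur. *)
Fixpoint level (e : exp) : nat :=
  match e with
  | Var l => l
  | Add a b | Mul a b => maxn (level a) (level b)
  | Scale _ a => level a
  end.

Fixpoint der (d : nat -> exp) (e : exp) : exp :=
  match e with
  | Var l => d l
  | Add a b => Add (der d a) (der d b)
  | Scale c a => Scale c (der d a)
  | Mul a b => Add (Mul (der d a) b) (Mul a (der d b))
  end.

Lemma level_der d e : (forall l, (level (d l) <= l.+1)%N) ->
  (level (der d e) <= (level e).+1)%N.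
Proof.
move=> dP; elim: e => //= a IHa b IHb; rewrite ?geq_max -!maxnSS.
  by rewrite !leq_max IHa IHb orbT.
by rewrite !leq_max IHa IHb !leqnSn !orbT.
Qed.

Lemma level_iter_der d e j : (forall l, (level (d l) <= l.+1)%N) ->
  (level (iter j (der d) e) <= level e + j)%N.
Proof.
move=> dP; elim: j => [|j IH]; first by rewrite addn0.
by rewrite addnS /=; apply: leq_trans (level_der _ dP) _.
Qed.

Lemma iter_derD d a b j :
  iter j (der d) (Add a b) = Add (iter j (der d) a) (iter j (der d) b).
Proof. by elim: j => //= j ->. Qed.

Lemma iter_derZ d c a j :
  iter j (der d) (Scale c a) = Scale c (iter j (der d) a).
Proof. by elim: j => //= j ->. Qed.

(** Each constructor corresponds to a closure property. Expressions have no constants, in agreement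
    with the requirement that every tensor product have at least one factor. *)
Lemma tensor_invariant_eval n K e : (level e <= K)%N ->
  tensor_invariant K (fun (g P : 'M[R]_n) Om =>
    eval (fun X Z => X *m g *m Z) (fun l => if l is 0 then P else Om l) e).
Proof.
elim: e => /= [[|l] H|a IHa b IHb|c a IHa H|a IHa b IHb].
- exact: (@tensor_invariant_single _ _ _ SymP).
- exact: (@tensor_invariant_single _ _ _ (SymOmega l.+1)).
- by rewrite geq_max => /andP[/IHa + /IHb]; apply: tensor_invariantD.
- exact/tensor_invariantZ/IHa.
- by rewrite geq_max => /andP[/IHa + /IHb]; apply: tensor_invariantM.
Qed.

(** Raising an index is a homomorphism: g^-1 (X g^-1 Z) = (g^-1 X) (g^-1 Z). *)
Lemma eval_mulmxl n (ginv : 'M[R]_n) (x : nat -> 'M[R]_n) e :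
  ginv *m eval (fun X Z => X *m ginv *m Z) x e = eval mulmx (fun l => ginv *m x l) e.
Proof.
elim: e => //= [a <- b <-|c a <-|a <- b <-].
- by rewrite mulmxDr.
- by rewrite scalemxAr.
- by rewrite !mulmxA.
Qed.

End Expressions.

(** * Smooth curves *)

Section Curves.
Variable R : realType.

Lemma derive1_val (V : normedModType R) (f : R -> V) (u : R) df :
  is_derive u 1 f df -> f^`() u = df.
Proof. by move=> [_ <-]; rewrite derive1E. Qed.

Lemma is_derive1 (V : normedModType R) (f : R -> V) (u : R) :
  derivable f u 1 -> is_derive u 1 f (f^`() u).
Proof. by move=> H; rewrite derive1E; apply: derivableP. Qed.

Lemma is_derive_mxP m n (A : R -> 'M[R]_(m, n)) (u : R) (dA : 'M[R]_(m, n)) :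
  (forall i j, is_derive u 1 (fun u => A u i j) (dA i j)) <-> is_derive u 1 A dA.
Proof.
split=> [H|[H <-] i j].
  have dH : derivable A u 1 by apply/derivable_mxP => i j; case: (H i j).
  split=> //; rewrite derive_mx //; apply/matrixP => i j; rewrite mxE.
  by case: (H i j).
split; first by move/derivable_mxP: H; apply.
by rewrite derive_mx // mxE.
Qed.

Lemma is_derive_mulr (f g : R -> R) (u df dg : R) :
  is_derive u 1 f df -> is_derive u 1 g dg ->
  is_derive u 1 (fun u => f u * g u) (df * g u + f u * dg).
Proof.
move=> Df Dg; apply: (is_derive_eq (is_deriveM Df Dg)).
by rewrite addrC /GRing.scale /= (mulrC (g u)).
Qed.

Lemma is_derive_mulmx m n p (A : R -> 'M[R]_(m, n)) (C : R -> 'M[R]_(n, p)) (u : R)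
    (dA : 'M[R]_(m, n)) (dC : 'M[R]_(n, p)) :
  is_derive u 1 A dA -> is_derive u 1 C dC ->
  is_derive u 1 (fun u => A u *m C u) (dA *m C u + A u *m dC).
Proof.
move=> /is_derive_mxP HA /is_derive_mxP HC; apply/is_derive_mxP => i j.
rewrite (_ : (fun u => _) = \sum_k (fun u => A u i k * C u k j)); last first.
  by apply/funext => t; rewrite mxE fct_sumE.
rewrite !mxE -big_split /=; apply: is_derive_sum => k.
exact: is_derive_mulr.
Qed.

Lemma is_derive_mxtrace n (A : R -> 'M[R]_n) (u : R) (dA : 'M[R]_n) :
  is_derive u 1 A dA -> is_derive u 1 (fun u => \tr (A u)) (\tr dA).
Proof.
move=> /is_derive_mxP HA.
rewrite (_ : (fun u => _) = \sum_k (fun u => A u k k)); last first.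
  by apply/funext => t; rewrite fct_sumE.
exact: is_derive_sum.
Qed.

Lemma is_derive_trmx m n (A : R -> 'M[R]_(m, n)) (u : R) (dA : 'M[R]_(m, n)) :
  is_derive u 1 A dA -> is_derive u 1 (fun u => (A u)^T) (dA^T).
Proof.
move=> /is_derive_mxP HA; apply/is_derive_mxP => i j; rewrite mxE.
by under eq_fun do rewrite mxE; apply: HA.
Qed.

(* Smoothness on U up to order k, unfolding one derivative at a time. *)
Fixpoint smooth_upto (V : normedModType R) (U : set R) k (f : R -> V) : Prop :=
  if k is k'.+1 then (forall u, U u -> derivable f u 1) /\ smooth_upto U k' f^`()
  else True.

Definition smooth_curve (V : normedModType R) (U : set R) (f : R -> V) :=
  forall k, smooth_upto U k f.

Section OpenSet.
Variable U : set R.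
Hypothesis U_open : open U.

Lemma near_open (u : R) (P : R -> Prop) :
  U u -> (forall t, U t -> P t) -> \forall t \near u, P t.
Proof.
move=> Uu HP; apply: filterS HP _; exact: open_nbhs_nbhs.
Qed.

Variable V : normedModType R.
Implicit Types f g : R -> V.

Lemma derive1_eq_on f g : (forall u, U u -> f u = g u) ->
  forall u, U u -> f^`() u = g^`() u.
Proof.
move=> fg u Uu; rewrite !derive1E; apply: near_eq_derive.
exact: near_open Uu fg.
Qed.

Lemma derive1n_eq_on f g k : (forall u, U u -> f u = g u) ->
  forall u, U u -> f^`(k) u = g^`(k) u.
Proof.
move=> fg; elim: k => [//|k IH] u Uu; rewrite !derive1nS.
exact: derive1_eq_on.
Qed.

Lemma smooth_upto_eq k f g : (forall u, U u -> f u = g u) ->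
  smooth_upto U k f -> smooth_upto U k g.
Proof.
elim: k f g => //= k IH f g fg [df sf]; split.
  move=> u Uu; apply: near_eq_derivable (df u Uu).
  exact: near_open Uu fg.
exact: IH (derive1_eq_on fg) sf.
Qed.

Lemma smooth_uptoS k f : smooth_upto U k.+1 f -> smooth_upto U k f.
Proof. by elim: k f => // k IH f [df /IH sf]. Qed.

Lemma smooth_curve_eq f g : (forall u, U u -> f u = g u) ->
  smooth_curve U f -> smooth_curve U g.
Proof. by move=> fg sf k; apply: smooth_upto_eq (sf k). Qed.

Lemma smooth_derivable f u : smooth_curve U f -> U u -> derivable f u 1.
Proof. by move=> sf Uu; apply: (sf 1%N).1. Qed.

Lemma smooth_is_derive f u : smooth_curve U f -> U u -> is_derive u 1 f (f^`() u).
Proof. by move=> sf Uu; apply/is_derive1/smooth_derivable. Qed.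

Lemma smooth_derive1 f : smooth_curve U f -> smooth_curve U f^`().
Proof. by move=> sf k; case: (sf k.+1). Qed.

Lemma smooth_derive1n f k : smooth_curve U f -> smooth_curve U f^`(k).
Proof. by move=> sf; elim: k => // k IH; rewrite derive1nS; apply: smooth_derive1. Qed.

Lemma smooth_curveP f :
  (forall k u, U u -> derivable f^`(k) u 1) -> smooth_curve U f.
Proof.
move=> H k; elim: k f H => //= k IH f H; split; first exact: (H 0%N).
by apply: IH => j u Uu; rewrite -derive1Sn; apply: H.
Qed.

Lemma smooth_cst (a : V) : smooth_curve U (fun=> a).
Proof.
(* The constant 0 is treated together with [a], since it is the derivative of both. *)
suff H k : smooth_upto U k (fun=> a) /\ smooth_upto U k (fun=> 0 : V) by move=> k; case: (H k).
have D (b : V) u : (fun=> b)^`() u = 0 :> V.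
  by apply: derive1_val; apply: is_derive_cst.
have {}D (b : V) : (fun=> b)^`() = (fun=> 0) :> (R -> V) by apply/funext => u.
by elim: k => //= k [_ IH]; rewrite !D; do !split=> //; move=> u _; apply: derivable_cst.
Qed.

Lemma smooth_uptoD k f g : smooth_upto U k f -> smooth_upto U k g ->
  smooth_upto U k (fun u => f u + g u).
Proof.
elim: k f g => //= k IH f g [df sf] [dg sg].
have D u : U u -> is_derive u 1 (fun u => f u + g u) (f^`() u + g^`() u).
  by move=> Uu; apply: is_deriveD; apply: is_derive1; [exact: df|exact: dg].
split=> [u /D[]//|].
by apply: (smooth_upto_eq _ (IH _ _ sf sg)) => u /D/derive1_val.
Qed.

Lemma smoothD f g : smooth_curve U f -> smooth_curve U g ->
  smooth_curve U (fun u => f u + g u).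
Proof. by move=> sf sg k; apply: smooth_uptoD. Qed.

Lemma smoothZ c f : smooth_curve U f -> smooth_curve U (fun u => c *: f u).
Proof.
move=> sf k; move: f sf; elim: k => //= k IH f sf.
have D u : U u -> is_derive u 1 (fun u => c *: f u) (c *: f^`() u).
  by move=> Uu; apply: is_deriveZ; apply: smooth_is_derive.
split=> [u /D[]//|].
apply: (smooth_upto_eq _ (IH _ (smooth_derive1 sf))).
by move=> u /D/derive1_val.
Qed.

End OpenSet.

(** Only the Leibniz rule is used, so scalar and matrix products are covered at once. The derivative
    is a sum of two products whose factors are smooth up to order k, the undifferentiated factor
    after forgetting one order. *)
Lemma smooth_upto_mul (U : set R) (V1 V2 V3 : normedModType R)
    (mul : V1 -> V2 -> V3) : open U ->
  (forall f g u df dg, is_derive u (1 : R) f df -> is_derive u 1 g dg ->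
     is_derive u 1 (fun u => mul (f u) (g u)) (mul df (g u) + mul (f u) dg)) ->
  forall k f g, smooth_upto U k f -> smooth_upto U k g ->
  smooth_upto U k (fun u => mul (f u) (g u)).
Proof.
move=> oU Dmul; elim=> [//|k IH] f g sf sg.
have [df sf'] := sf; have [dg sg'] := sg.
have D u : U u -> is_derive u 1 (fun u => mul (f u) (g u))
    (mul (f^`() u) (g u) + mul (f u) (g^`() u)).
  by move=> Uu; apply: Dmul; apply: is_derive1; [exact: df|exact: dg].
split=> [u /D[]//|].
apply: (@smooth_upto_eq _ oU _ _ (fun u => mul (f^`() u) (g u) + mul (f u) (g^`() u))).
  by move=> u /D/derive1_val.
by apply: smooth_uptoD => //; apply: IH => //; apply: smooth_uptoS.
Qed.

Lemma smooth_upto_mulr U k (f g : R -> R) : open U ->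
  smooth_upto U k f -> smooth_upto U k g -> smooth_upto U k (fun u => f u * g u).
Proof.
move=> oU; apply: smooth_upto_mul => // *; exact: is_derive_mulr.
Qed.

Lemma smooth_mulr U (f g : R -> R) : open U -> smooth_curve U f -> smooth_curve U g ->
  smooth_curve U (fun u => f u * g u).
Proof. by move=> oU sf sg k; apply: smooth_upto_mulr. Qed.

Lemma smooth_mulmx U m n p (A : R -> 'M[R]_(m, n)) (C : R -> 'M[R]_(n, p)) :
  open U -> smooth_curve U A -> smooth_curve U C -> smooth_curve U (fun u => A u *m C u).
Proof.
move=> oU sA sC k; apply: (smooth_upto_mul oU _ (sA k) (sC k)) => *.
exact: is_derive_mulmx.
Qed.

Lemma smooth_mxP U m n (A : R -> 'M[R]_(m, n)) : open U ->
  smooth_curve U A <-> forall i j, smooth_curve U (fun u => A u i j).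
Proof.
move=> oU; split=> [sA i j k|sA k]; move: A sA; elim: k => //= k IH A sA.
  have D u : U u -> is_derive u 1 (fun u => A u i j) (A^`() u i j).
    by move=> Uu; have /is_derive_mxP := smooth_is_derive sA Uu; apply.
  split=> [u /D[]//|].
  by apply: (smooth_upto_eq oU _ (IH _ (smooth_derive1 sA))) => u /D/derive1_val.
have D u : U u -> is_derive u 1 A (\matrix_(i, j) (fun u => A u i j)^`() u).
  by move=> Uu; apply/is_derive_mxP => i j; rewrite mxE; apply: smooth_is_derive.
split=> [u /D[]//|].
apply: (smooth_upto_eq oU _ (IH (fun u => \matrix_(i, j) (fun u => A u i j)^`() u) _)).
  by move=> u /D/derive1_val.
by move=> i j; under eq_fun do rewrite mxE; apply: smooth_derive1.
Qed.

Lemma smooth_sum U (I : Type) (s : seq I) (f : I -> R -> R) : open U ->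
  (forall i, smooth_curve U (f i)) -> smooth_curve U (fun u => \sum_(i <- s) f i u).
Proof.
move=> oU sf; elim: s => [|i s IH].
  by under eq_fun do rewrite big_nil; apply: smooth_cst.
by under eq_fun do rewrite big_cons; apply: smoothD.
Qed.

Lemma smooth_prod U (I : Type) (s : seq I) (f : I -> R -> R) : open U ->
  (forall i, smooth_curve U (f i)) -> smooth_curve U (fun u => \prod_(i <- s) f i u).
Proof.
move=> oU sf; elim: s => [|i s IH].
  by under eq_fun do rewrite big_nil; apply: smooth_cst.
by under eq_fun do rewrite big_cons; apply: smooth_mulr.
Qed.

Lemma smooth_det U n (A : R -> 'M[R]_n) : open U -> smooth_curve U A ->
  smooth_curve U (fun u => \det (A u)).
Proof.
move=> oU /(smooth_mxP _ oU) sA; apply: smooth_sum => // s.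
by apply: smooth_mulr => //; [exact: smooth_cst|apply: smooth_prod].
Qed.

(** The derivative - f' f^-1 f^-1 is a product of f' and of f^-1 itself, so smoothness of f^-1 up to
    order k yields order k + 1. *)
Lemma smooth_inv U (f : R -> R) : open U -> smooth_curve U f ->
  (forall u, U u -> f u != 0) -> smooth_curve U (fun u => (f u)^-1).
Proof.
move=> oU sf f0.
have D u : U u -> is_derive u 1 (fun u => (f u)^-1) (- f^`() u * (f u)^-1 * (f u)^-1).
  move=> Uu; have Df := smooth_is_derive sf Uu; have fu0 := f0 u Uu.
  apply: (is_derive_eq (is_deriveV fu0 Df)); rewrite scaleNr mulNr mulNr; congr (- _).
  by rewrite /GRing.scale /= expr2 invfM mulrC mulrA.
elim=> //= k IH; split=> [u /D[]//|].
apply: (smooth_upto_eq oU (f := fun u => - f^`() u * (f u)^-1 * (f u)^-1)).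
  by move=> u /D/derive1_val.
do 2![apply: smooth_upto_mulr => //].
under eq_fun do rewrite -scaleN1r.
exact: (smoothZ oU _ (smooth_derive1 sf)).
Qed.

(** By Cramer's rule the entries of the inverse are polynomials in the entries of A divided by the
    determinant. *)
Lemma smooth_invmx U n (A : R -> 'M[R]_n) : open U -> smooth_curve U A ->
  (forall u, U u -> A u \in unitmx) -> smooth_curve U (fun u => invmx (A u)).
Proof.
move=> oU sA uA.
have sD : smooth_curve U (fun u => (\det (A u))^-1).
  by apply: smooth_inv => // [|u /uA]; [exact: smooth_det|rewrite unitmxE unitfE].
apply: (@smooth_curve_eq _ oU _ (fun u => (\det (A u))^-1 *: \adj (A u))).
  by move=> u /uA uAu; rewrite /invmx uAu.
apply/smooth_mxP => // i j; under eq_fun do rewrite !mxE /cofactor.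
apply: smooth_mulr => //; apply: smooth_mulr => //; first exact: smooth_cst.
apply: smooth_det => //; apply/smooth_mxP => // a b.
by under eq_fun do rewrite !mxE; move/smooth_mxP : sA; apply.
Qed.

Lemma is_derive_prod (I : eqType) (r : seq I) (f : I -> R -> R) (u : R) (df : I -> R) :
  uniq r -> (forall i, is_derive u 1 (f i) (df i)) ->
  is_derive u 1 (fun u => \prod_(i <- r) f i u)
    (\sum_(i <- r) df i * \prod_(j <- r | j != i) f j u).
Proof.
move=> + Df; elim: r => [_|a r IH /= /andP[ar /IH{}IH]].
  by under eq_fun do rewrite big_nil; rewrite big_nil; apply: is_derive_cst.
under eq_fun do rewrite big_cons.
apply: (is_derive_eq (is_derive_mulr (Df a) IH)).
rewrite big_cons big_cons eqxx /=; congr (_ * _ + _).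
  rewrite [LHS]big_seq [RHS]big_seq_cond; apply: eq_bigl => i.
  by case: eqP => [->|_]; rewrite ?andbT // (negbTE ar).
rewrite mulr_sumr [LHS]big_seq [RHS]big_seq; apply: eq_bigr => i ir.
rewrite big_cons; case: eqP => [ai|_]; first by rewrite ai ir in ar.
by rewrite mulrCA.
Qed.

(** Jacobi's formula. Differentiating the Leibniz expansion gives a sum, over the rows, of
    determinants in which one row is differentiated; each is then expanded along that row. *)
Lemma is_derive_det n (A : R -> 'M[R]_n) (u : R) (dA : 'M[R]_n) :
  is_derive u 1 A dA ->
  is_derive u 1 (fun u => \det (A u)) (\tr (dA *m \adj (A u))).
Proof.
move=> /is_derive_mxP DA.
(* [rep i] is A at u with its i-th row replaced by that of [dA]; the minors along this row are those
   of A. *)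
pose rep i := \matrix_(a, b) if a == i then dA a b else A u a b.
have repE i : \det (rep i) = (dA *m \adj (A u)) i i.
  rewrite (expand_det_row _ i) mxE; apply: eq_bigr => b _.
  rewrite !mxE eqxx; congr (_ * (_ * \det _)).
  by apply/matrixP => a c; rewrite !mxE eq_sym (negbTE (neq_lift _ _)).
rewrite /mxtrace; under eq_bigr do rewrite -repE /determinant.
rewrite exchange_big /=.
pose D (s : 'S_n) u := (-1) ^+ s * \prod_i A u i (s i).
have -> : (fun u => \det (A u)) = (fun u => \sum_(s <- index_enum 'S_n) D s u) by [].
have Dsum (r : seq 'S_n) (dD : 'S_n -> R) : (forall s, is_derive u 1 (D s) (dD s)) ->
    is_derive u 1 (fun u => \sum_(s <- r) D s u) (\sum_(s <- r) dD s).
  move=> DD; elim: r => [|s r IH].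
    by under eq_fun do rewrite big_nil; rewrite big_nil; apply: is_derive_cst.
  by under eq_fun do rewrite big_cons; rewrite big_cons; apply: is_deriveD.
apply: Dsum => s.
have DP := is_derive_prod (index_enum_uniq 'I_n) (fun i => DA i (s i)).
have H := is_derive_mulr (is_derive_cst ((-1) ^+ s : R) u 1) DP.
apply: (is_derive_eq H).
rewrite mul0r add0r mulr_sumr; apply: eq_bigr => i _; congr (_ * _).
rewrite [RHS](bigD1 i) //= mxE eqxx; congr (_ * _).
by apply: eq_bigr => j /negbTE ji; rewrite mxE ji.
Qed.

(** * Iterated derivatives, and jets of flat functions *)

Lemma derive1nZ (V : normedModType R) U k c (f : R -> V) : open U ->
  smooth_curve U f -> forall u, U u -> (fun u => c *: f u)^`(k) u = c *: f^`(k) u.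
Proof.
move=> oU; elim: k f => [//|k IH] f sf u Uu.
rewrite !derive1Sn -IH //; last exact: smooth_derive1.
apply: (derive1n_eq_on oU) Uu => t Ut.
by apply: derive1_val; apply: is_deriveZ; apply: smooth_is_derive Ut.
Qed.

Lemma derive1nD (V : normedModType R) U k (f g : R -> V) : open U ->
  smooth_curve U f -> smooth_curve U g ->
  forall u, U u -> (fun u => f u + g u)^`(k) u = f^`(k) u + g^`(k) u.
Proof.
move=> oU; elim: k f g => [//|k IH] f g sf sg u Uu.
rewrite !derive1Sn -IH //; try exact: smooth_derive1.
apply: (derive1n_eq_on oU) Uu => t Ut.
by apply: derive1_val; apply: is_deriveD; apply: smooth_is_derive Ut.
Qed.

Lemma derive1n_mx U k m n (A : R -> 'M[R]_(m, n)) i j : open U ->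
  smooth_curve U A -> forall u, U u -> (fun u => A u i j)^`(k) u = A^`(k) u i j.
Proof.
move=> oU; elim: k A => [//|k IH] A sA u Uu.
rewrite !derive1Sn -IH //; last exact: smooth_derive1.
apply: (derive1n_eq_on oU) Uu => t Ut; apply: derive1_val.
by have /is_derive_mxP := smooth_is_derive sA Ut; apply.
Qed.

(** Induction on k. The bound for f' is integrated by applying the mean value theorem to the
    difference of f and the monomial; this difference vanishes at 0. *)
Lemma taylor_lower (U : set R) k (f : R -> R) (e c : R) : open U ->
  smooth_curve U f -> (forall t, 0 <= t < e -> U t) ->
  (forall t, 0 <= t < e -> c <= f^`(k) t) -> (forall j, (j < k)%N -> f^`(j) 0 = 0) ->
  forall t, 0 <= t < e -> c * (t ^+ k / k`!%:R) <= f t.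
Proof.
move=> oU + eU; elim: k f => [|k IH] f sf fk f0 t te.
  by rewrite expr0 divr1 mulr1; apply: fk.
have {}IH s : 0 <= s < e -> c * (s ^+ k / k`!%:R) <= f^`() s.
  apply: IH; first exact: smooth_derive1.
    by move=> r re; rewrite -derive1Sn; apply: fk.
  by move=> j jk; rewrite -derive1Sn; apply: f0.
have /andP[t0 t1] := te.
move: t0; rewrite le_eqVlt => /predU1P[<-|t0].
  by rewrite exprS !mul0r mulr0; have := f0 0%N isT; rewrite derive1n0 => ->.
pose G := fun s => f s - c * (s ^+ k.+1 / k.+1`!%:R).
have DG s : 0 <= s < e -> is_derive s 1 G (f^`() s - c * (s ^+ k / k`!%:R)).
  move=> /eU Us.
  have DX : is_derive s 1 (fun s : R => s ^+ k.+1) (k.+1%:R * s ^+ k).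
    by split; [exact: exprn_derivable|rewrite exp_derive scaler1].
  have H := is_deriveB (smooth_is_derive sf Us) (is_deriveZ (c / k.+1`!%:R) DX).
  have -> : G = f - (c / k.+1`!%:R) \*: (fun s => s ^+ k.+1).
    by apply/funext => r; congr (_ - _); rewrite mulrCA mulrC.
  apply: (is_derive_eq H); congr (_ - _); rewrite /GRing.scale /= factS natrM.
  by field; rewrite nat1r !pnatr_eq0 -lt0n fact_gt0.
have sub s : 0 <= s <= t -> 0 <= s < e by move=> /andP[-> /le_lt_trans]; apply.
have GI s : s \in `]0, t[ -> is_derive s 1 G (f^`() s - c * (s ^+ k / k`!%:R)).
  by rewrite in_itv /= => /andP[s0 st]; apply/DG/sub; rewrite !ltW.
have GC : {within `[0, t], continuous G}.
  apply: derivable_within_continuous => s; rewrite in_itv /= => /sub/DG[].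
  by [].
have [z zt] := MVT_segment (ltW t0) GI GC.
have -> : G 0 = 0.
  by rewrite /G exprS !mul0r mulr0 subr0; have := f0 0%N isT.
rewrite !subr0 /G => Gz; rewrite -subr_ge0 Gz.
move: zt; rewrite in_itv /= => /sub/IH; rewrite -subr_ge0 => Hz.
by rewrite mulr_ge0 // ltW.
Qed.

(** If a = h^(k)(0) were positive, continuity would give h^(k) >= a/2 near 0, hence h(t) >= (a/2)
    t^k / k! for small t > 0. This contradicts the bound C t^(k+1). *)
Lemma flat_derive1n_le0 (U : set R) (h : R -> R) k : open U -> U 0 -> smooth_curve U h ->
  (forall N, exists C, \forall u \near 0, `|h u| <= C * `|u| ^+ N) ->
  (forall j, (j < k)%N -> h^`(j) 0 = 0) -> h^`(k) 0 <= 0.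
Proof.
move=> oU U0 sh hO h0; rewrite leNgt; apply/negP => a0.
set a := h^`(k) 0 in a0.
have [C hC] := hO k.+1.
have ck : \forall t \near 0, a / 2 <= h^`(k) t.
  have cont : {for 0, continuous h^`(k)}.
    apply/differentiable_continuous/derivable1_diffP.
    exact: smooth_derivable (smooth_derive1n k sh) U0.
  by apply: (cvgr_ge _ cont); rewrite -/a ltr_pdivrMr // mulr_natr mulr2n ltrDl.
have oU0 : \forall t \near 0, U t by exact: open_nbhs_nbhs.
have [e /= e0 He] : \forall t \near (0 : R), [/\ U t, a / 2 <= h^`(k) t &
    `|h t| <= C * `|t| ^+ k.+1].
  by near=> t; split; near: t.
have {}He t : 0 <= t < e -> [/\ U t, a / 2 <= h^`(k) t & `|h t| <= C * `|t| ^+ k.+1].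
  move=> /andP[t0 te]; apply: He => /=.
  by rewrite sub0r normrN ger0_norm.
have lower t : 0 <= t < e -> a / 2 * (t ^+ k / k`!%:R) <= h t.
  by apply: (taylor_lower oU sh) => // s /He[].
have upper t : 0 < t < e -> a / 2 / k`!%:R <= C * t.
  move=> /andP[t0 te]; have te' : 0 <= t < e by rewrite ltW.
  have [_ _] := He t te'; rewrite (ger0_norm (ltW t0)) => H.
  rewrite -(ler_pM2r (exprn_gt0 k t0)); apply: (@le_trans _ _ (h t)).
    by apply: le_trans (lower t te'); rewrite mulrAC -mulrA.
  by apply: le_trans (le_trans (ler_norm _) H) _; rewrite exprS mulrA.
pose b := a / 2 / k`!%:R.
have b0 : 0 < b by rewrite !divr_gt0 // ltr0n fact_gt0.
have C0 : 0 < `|C| + 1 by rewrite ltr_wpDl.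
(* The point t lies inside the interval of validity and satisfies (|C| + 1) t < b. The sign of C is
   unknown, and adding 1 to |C| keeps the denominator positive. *)
pose t := Num.min (e / 2) (b / (`|C| + 1) / 2).
have t0 : 0 < t by rewrite lt_min !divr_gt0.
have te : t < e by rewrite gt_min ltr_pdivrMr // mulr_natr mulr2n ltrDl e0.
have := upper t; rewrite t0 te => /(_ isT); apply/negP; rewrite -ltNge -/b.
have : (`|C| + 1) * t < b.
  rewrite -ltr_pdivlMl // gt_min; apply/orP; right.
  by rewrite [X in _ < X]mulrC ltr_pdivrMr // mulr_natr mulr2n ltrDl divr_gt0.
apply: le_lt_trans; rewrite ler_pM2r //.
by apply: le_trans (ler_norm _) _; rewrite lerDl.
Unshelve. all: by end_near. Qed.

(** Strong induction on k, with the one-sided result applied to h and to - h. *)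
Lemma flat_derive1n (U : set R) (h : R -> R) : open U -> U 0 -> smooth_curve U h ->
  (forall N, exists C, \forall u \near 0, `|h u| <= C * `|u| ^+ N) ->
  forall k, h^`(k) 0 = 0.
Proof.
move=> oU U0 sh hO; elim/ltn_ind => k IH; apply/eqP; rewrite eq_le.
rewrite (flat_derive1n_le0 oU U0 sh) //=.
have D j : (fun u => -1 *: h u)^`(j) 0 = - h^`(j) 0.
  by rewrite (derive1nZ _ _ oU sh U0) scaleN1r.
rewrite -oppr_le0 -D; apply: (flat_derive1n_le0 oU U0).
- exact: smoothZ.
- move=> N; have [C HC] := hO N; exists C.
  by apply: filterS HC => u; rewrite scaleN1r normrN.
- by move=> j jk; rewrite D IH ?oppr0.
Qed.

End Curves.

(** * Jets of a curve of metrics *)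

Section MetricJets.
Variables (R : realType) (n : nat) (U : set R) (g : R -> 'M[R]_n) (phi : R -> R).
Hypothesis U_open : open U.
Hypothesis U0 : U 0.
Hypothesis g_smooth : smooth_curve U g.
Hypothesis g_unit : forall u, U u -> g u \in unitmx.
Hypothesis phi_smooth : smooth_curve U phi.

Definition shape u : 'M[R]_n := 2^-1 *: (invmx (g u) *m g^`() u).

(* gen l = g^-1 (Omega_phi)^(l) for l > 0. *)
Fixpoint gen l : R -> 'M[R]_n :=
  if l is l'.+1 then fun u => (gen l')^`() u +
      (if l' is 0 then shape u *m shape u
       else shape u *m gen l' u + -1 *: (gen l' u *m shape u))
  else shape.

Lemma genSS l u : gen l.+2 u = (gen l.+1)^`() u +
  (shape u *m gen l.+1 u + -1 *: (gen l.+1 u *m shape u)).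
Proof. by []. Qed.

(** The recursion of [gen] solved for the derivatives: B' = E_1 - B^2 and E_l' = E_(l+1) - B E_l +
    E_l B. *)
Definition dgen l : exp R :=
  if l is 0 then Add (Var R 1) (Scale (-1) (Mul (Var R 0) (Var R 0)))
  else Add (Var R l.+1) (Add (Scale (-1) (Mul (Var R 0) (Var R l)))
                             (Mul (Var R l) (Var R 0))).

Lemma level_dgen l : (level (dgen l) <= l.+1)%N.
Proof. by case: l => //= l; rewrite !geq_max !leqnn !leqnSn. Qed.

Definition eval_gen e u := eval mulmx (fun l => gen l u) e.

Lemma smooth_gen l : smooth_curve U (gen l).
Proof.
have s0 : smooth_curve U (gen 0).
  apply: smoothZ => //; apply: smooth_mulmx => //; last exact: smooth_derive1.
  exact: smooth_invmx.
elim: l => [//|l IH]; apply: smoothD => //; first exact: smooth_derive1.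
case: l IH => [|l] IH; first exact: smooth_mulmx.
by apply: smoothD => //; [|apply: smoothZ => //]; apply: smooth_mulmx.
Qed.

Lemma eval_gen_dgen l u : eval_gen (dgen l) u = (gen l)^`() u.
Proof.
have cancel_commutator (d x z : 'M[R]_n) : d + (x + -1 *: z) + (-1 *: x + z) = d.
  by rewrite !scaleN1r -addrA addrACA subrr add0r addNr addr0.
case: l => [|l]; first by rewrite /eval_gen /= scaleN1r addrK.
change (gen l.+2 u + (-1 *: (shape u *m gen l.+1 u) + gen l.+1 u *m shape u)
  = (gen l.+1)^`() u).
rewrite genSS.
exact: cancel_commutator.
Qed.

Lemma is_derive_eval_gen e u : U u -> is_derive u 1 (eval_gen e) (eval_gen (der dgen e) u).
Proof.
move=> Uu; elim: e => [l|a IHa b IHb|c a IHa|a IHa b IHb].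
- by rewrite /= eval_gen_dgen; apply: smooth_is_derive Uu; apply: smooth_gen.
- exact: is_deriveD.
- exact: is_deriveZ.
- exact: is_derive_mulmx.
Qed.

Lemma smooth_eval_gen e : smooth_curve U (eval_gen e).
Proof.
apply: smooth_curveP => k u; elim: k e => [|k IH] e Uu.
  by case: (is_derive_eval_gen e Uu).
rewrite derive1Sn; have := IH (der dgen e) Uu; apply: near_eq_derivable.
apply: (near_open U_open Uu) => t Ut; apply: (derive1n_eq_on U_open) Ut => s Us.
by rewrite (derive1_val (is_derive_eval_gen e Us)).
Qed.

Lemma derive1n_eval_gen e j u : U u -> (eval_gen e)^`(j) u = eval_gen (iter j (der dgen) e) u.
Proof.
elim: j e u => [//|j IH] e u Uu; rewrite derive1Sn iterSr -IH //.
by apply: (derive1n_eq_on U_open) Uu => t Ut; apply: derive1_val; apply: is_derive_eval_gen.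
Qed.

Lemma derive1n_trace (A : R -> 'M[R]_n) j u : smooth_curve U A -> U u ->
  (fun u => \tr (A u))^`(j) u = \tr (A^`(j) u).
Proof.
elim: j A u => [//|j IH] A u sA Uu; rewrite !derive1Sn -IH //; last exact: smooth_derive1.
apply: (derive1n_eq_on U_open) Uu => t Ut; apply: derive1_val.
by apply: is_derive_mxtrace; apply: smooth_is_derive Ut.
Qed.

Lemma smooth_trace (A : R -> 'M[R]_n) : smooth_curve U A ->
  smooth_curve U (fun u => \tr (A u)).
Proof. by move/(smooth_mxP _ U_open) => sA; apply: smooth_sum. Qed.

(* g^(k+1) = g * metric_exp k *)
Fixpoint metric_exp k : exp R :=
  if k is k'.+1 then
    Add (Mul (Scale 2 (Var R 0)) (metric_exp k')) (der dgen (metric_exp k'))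
  else Scale 2 (Var R 0).

Lemma level_metric_exp k : (level (metric_exp k) <= k)%N.
Proof.
elim: k => // k IH; rewrite /= max0n geq_max (leq_trans IH) ?leqnSn //=.
exact: leq_trans (level_der _ level_dgen) _.
Qed.

Lemma derive1_metric u : U u -> g^`() u = g u *m eval_gen (Scale 2 (Var R 0)) u.
Proof.
move=> Uu; rewrite /eval_gen /= scalerA divff ?pnatr_eq0 // scale1r.
by rewrite mulKVmx ?g_unit.
Qed.

Lemma derive1n_metric k u : U u -> g^`(k.+1) u = g u *m eval_gen (metric_exp k) u.
Proof.
elim: k u => [|k IH] u Uu; first by rewrite derive1n1 derive1_metric.
rewrite derive1nS (derive1_eq_on U_open IH) //.
rewrite (derive1_val (is_derive_mulmx (smooth_is_derive g_smooth Uu) (is_derive_eval_gen _ Uu))).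
by rewrite derive1_metric // -mulmxA -mulmxDr.
Qed.

(** With q_j = [metric_exp j], the recursion q_(j+1)/2 = B q_j + (q_j/2)' has the pure derivatives
    of B as its leading part. What is left obeys h_j = B q_j + h_(j-1)', one level below q_(j+1). As
    there are no constants, [Scale 0 (Var 0)] serves as zero at the start. *)
Fixpoint half_metric_exp j : exp R :=
  Add (Mul (Var R 0) (metric_exp j))
      (if j is j'.+1 then der dgen (half_metric_exp j') else Scale 0 (Var R 0)).

Lemma level_half_metric_exp j : (level (half_metric_exp j) <= j)%N.
Proof.
elim: j => [//|j IH]; have := level_metric_exp j.+1.
rewrite /= !max0n !geq_max => -> /=.
exact: leq_trans (level_der _ level_dgen) _.
Qed.

(* The highest generators of g^-1 g^(j+2) / 2 are those of (gen 0)^(j+1). *)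
Lemma half_metric_exp_eq j u : U u ->
  2^-1 *: eval_gen (metric_exp j.+1) u
  = eval_gen (iter j.+1 (der dgen) (Var R 0)) u + eval_gen (half_metric_exp j) u.
Proof.
have E0 k t : 2^-1 *: eval_gen (metric_exp k.+1) t
    = gen 0 t *m eval_gen (metric_exp k) t + 2^-1 *: eval_gen (der dgen (metric_exp k)) t.
  rewrite [eval_gen (metric_exp _) _]/eval_gen /= scalerDr -scalemxAl scalerA mulVf ?pnatr_eq0 //.
  by rewrite scale1r.
elim: j u => [|j IH] u Uu; rewrite E0.
  rewrite addrC [eval_gen (half_metric_exp _) _]/eval_gen /= scale0r addr0; congr (_ + _).
  by rewrite [eval_gen (Scale _ _) _]/eval_gen /= scalerA mulVf ?pnatr_eq0 // scale1r.
have DL : (fun t => 2^-1 *: eval_gen (metric_exp j.+1) t)^`() u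
    = 2^-1 *: eval_gen (der dgen (metric_exp j.+1)) u.
  by apply: derive1_val; apply: is_deriveZ; apply: is_derive_eval_gen.
rewrite -DL (derive1_eq_on U_open IH) //.
rewrite (derive1_val (is_deriveD (is_derive_eval_gen _ Uu) (is_derive_eval_gen _ Uu))).
by rewrite addrCA.
Qed.

Lemma half_trace_metric j :
  2^-1 * \tr (invmx (g 0) *m g^`(j.+2) 0)
  = \tr (eval_gen (iter j.+1 (der dgen) (Var R 0)) 0) + \tr (eval_gen (half_metric_exp j) 0).
Proof.
rewrite derive1n_metric // mulKmx ?g_unit //.
by rewrite -linearD -half_metric_exp_eq // linearZ.
Qed.

(** The equation in the direction (oo, oo), in the form in which an O(u^oo) condition can be
    exploited: equality of jets at u = 0. *)
Hypothesis phi_flat : forall j,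
  (fun u => phi^`(2) u + -1 *: \tr (gen 1 u))^`(j) 0 = 0.

Lemma derive1n_phi j : phi^`(j.+2) 0 = \tr (eval_gen (iter j (der dgen) (Var R 1)) 0).
Proof.
have s1 : smooth_curve U (fun u => \tr (gen 1 u)) by apply/smooth_trace/(smooth_gen 1).
have s2 : smooth_curve U phi^`(2) by exact: smooth_derive1n.
have := phi_flat j; rewrite (derive1nD _ U_open) //; last exact: smoothZ.
rewrite (derive1nZ _ _ U_open) // scaleN1r => /eqP; rewrite subr_eq0 => /eqP H.
rewrite -derive1n_eval_gen // -derive1n_trace //; last exact: smooth_eval_gen.
by rewrite -[RHS]H /derive1n -iterD addn2.
Qed.

(* The derivative of log (det g)^(1/2) - phi. *)
Definition logvol' u := \tr (gen 0 u) + -1 *: phi^`() u.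

Lemma smooth_logvol' : smooth_curve U logvol'.
Proof.
apply: smoothD => //; first by apply/smooth_trace/(smooth_gen 0).
by apply: smoothZ => //; apply: smooth_derive1.
Qed.

Definition shape_sq : exp R := Mul (Var R 0) (Var R 0).

Lemma derive1n_logvol' j :
  logvol'^`(j.+1) 0 = - \tr (eval_gen (iter j (der dgen) shape_sq) 0).
Proof.
rewrite (derive1nD _ U_open) //; first last.
- by apply: smoothZ => //; apply: smooth_derive1.
- exact/smooth_trace/(smooth_gen 0).
rewrite (derive1nZ _ _ U_open) //; last exact: smooth_derive1.
rewrite -derive1Sn derive1n_phi derive1n_trace //; last exact: smooth_gen 0.
rewrite (derive1n_eval_gen (Var R 0)) // iterSr /= iter_derD iter_derZ.
by rewrite [eval_gen (Add _ _) _]/eval_gen /= linearD linearZ /= !scaleN1r mulN1r addrAC subrr add0r.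
Qed.

(** The (j+1)-st derivative of B is the j-th derivative of E_1 - B^2, and its E_1 part has the trace
    phi^(j+2). The two terms that survive have level at most j, two less than the order j + 2. *)
Lemma trace_metric_phi j :
  2^-1 * \tr (invmx (g 0) *m g^`(j.+2) 0) - phi^`(j.+2) 0
  = \tr (eval_gen (half_metric_exp j) 0) - \tr (eval_gen (iter j (der dgen) shape_sq) 0).
Proof.
rewrite half_trace_metric derive1n_phi iterSr /= iter_derD iter_derZ.
rewrite [eval_gen (Add _ _) _]/eval_gen /= linearD linearZ /= mulN1r.
by rewrite addrAC addrC; congr (_ + _); rewrite addrAC subrr add0r.
Qed.

(** * The weighted volume density and its derivatives *)

Definition vol u :=
  expR (- phi u) / expR (- phi 0) * Num.sqrt (\det (g u) / \det (g 0)).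

Lemma vol0 : vol 0 = 1.
Proof.
have := g_unit U0; rewrite unitmxE unitfE => d0.
by rewrite /vol !divff // ?gt_eqF ?expR_gt0 // sqrtr1 mulr1.
Qed.

(** The square root is differentiated where its argument is positive. On [U] the determinants are
    nonzero, but [U] is not known to be connected, so the sign of the quotient is controlled only
    near 0. *)
Definition volU := U `&` [set u | 0 < \det (g u) / \det (g 0)].

Lemma volU0 : volU 0.
Proof.
split=> //=; rewrite divff //.
by have := g_unit U0; rewrite unitmxE unitfE.
Qed.

Lemma volU_open : open volU.
Proof.
rewrite openE => u [Uu du]; rewrite /interior; near=> t.
split; near: t; first exact: open_nbhs_nbhs.
have sd : smooth_curve U (fun u => (\det (g 0))^-1 *: \det (g u)).
  by apply: smoothZ => //; apply: smooth_det.
have c : {for u, continuous (fun u => (\det (g 0))^-1 *: \det (g u))}.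
  by apply/differentiable_continuous/derivable1_diffP; apply: smooth_derivable sd Uu.
have du' : 0 < (\det (g 0))^-1 *: \det (g u) by rewrite /GRing.scale /= mulrC.
have H : \forall t \near u, 0 < (\det (g 0))^-1 *: \det (g t) by apply: (cvgr_gt _ c).
by apply: filterS H => s; rewrite /GRing.scale /= mulrC.
Unshelve. all: by end_near. Qed.

(** By Jacobi's formula the logarithmic derivative of det g is tr (g^-1 g') = 2 tr B, and the square
    root halves it; the exponential contributes - phi'. *)
Lemma is_derive_vol u : volU u -> is_derive u 1 vol (logvol' u * vol u).
Proof.
move=> [Uu du].
have Dphi := smooth_is_derive phi_smooth Uu.
have De : is_derive u 1 (fun t => expR (- phi t)) (- phi^`() u * expR (- phi u)).
  apply: (is_derive_eq (is_derive1_comp (is_derive_expR _) (is_deriveN Dphi))).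
  by rewrite mulrC.
have Dd : is_derive u 1 (fun t => \det (g t) / \det (g 0))
    (2 * \tr (gen 0 u) * (\det (g u) / \det (g 0))).
  have := is_derive_mulr (is_derive_det (smooth_is_derive g_smooth Uu))
    (is_derive_cst ((\det (g 0))^-1) u 1).
  move/is_derive_eq; apply; rewrite mulr0 addr0 mulrA; congr (_ * _).
  rewrite linearZ /= mulrA divff ?pnatr_eq0 // mul1r mxtrace_mulC.
  have gu := g_unit Uu; rewrite /invmx gu -scalemxAl linearZ /= mulrAC mulVf ?mul1r //.
  by move: gu; rewrite unitmxE unitfE.
have Ds := @is_derive1_comp R Num.sqrt (fun t => \det (g t) / \det (g 0)) u _ _
  (is_derive1_sqrt du) Dd.
set q := \det (g u) / \det (g 0) in du Dd Ds *.
have sq : 0 < Num.sqrt q by rewrite sqrtr_gt0.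
have {}Ds : is_derive u 1 (fun t => Num.sqrt (\det (g t) / \det (g 0)))
    (\tr (gen 0 u) * Num.sqrt q).
  apply: (is_derive_eq Ds); rewrite -[X in _ * X = _]mulr1.
  (* Written as a square, q makes the identity rational in its root. *)
  have {2}-> : q = Num.sqrt q ^+ 2 by rewrite sqr_sqrtr // ltW.
  by field; rewrite gt_eqF.
have := is_derive_mulr (is_derive_mulr De (is_derive_cst ((expR (- phi 0))^-1) u 1)) Ds.
move/is_derive_eq; apply; rewrite /vol /logvol' -/q scaleN1r.
set E := expR _; set E' := (expR _)^-1; rewrite /cst.
ring.
Qed.

(* vol^(k+1) = vol_exp k * vol, the l-th variable being logvol'^(l). *)
Fixpoint vol_exp k : exp R :=
  if k is k'.+1 then
    Add (der (fun l => Var R l.+1) (vol_exp k')) (Mul (Var R 0) (vol_exp k'))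
  else Var R 0.

Lemma level_vol_exp k : (level (vol_exp k) <= k)%N.
Proof.
elim: k => // k IH; rewrite /= max0n geq_max andbC (leq_trans IH) ?leqnSn //=.
by apply: leq_trans (level_der _ _) _.
Qed.

Definition eval_logvol e u : R^o := @eval R R^o *%R (fun l => logvol'^`(l) u) e.

Lemma is_derive_eval_logvol e u : U u ->
  is_derive u 1 (eval_logvol e) (eval_logvol (der (fun l => Var R l.+1) e) u).
Proof.
move=> Uu; elim: e => [l|a IHa b IHb|c a IHa|a IHa b IHb].
- by apply: smooth_is_derive Uu; apply/smooth_derive1n/smooth_logvol'.
- exact: is_deriveD.
- exact: is_deriveZ.
- exact: is_derive_mulr.
Qed.

(** The formula of Faa di Bruno for an exponential: [vol_exp] is a complete Bell polynomial in the
    derivatives of the logarithm. *)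
Lemma derive1n_vol k u : volU u -> vol^`(k.+1) u = eval_logvol (vol_exp k) u * vol u.
Proof.
elim: k u => [|k IH] u Vu.
  by rewrite derive1n1 (derive1_val (is_derive_vol Vu)).
rewrite derive1nS (derive1_eq_on volU_open IH) //.
rewrite (derive1_val (is_derive_mulr (is_derive_eval_logvol _ Vu.1) (is_derive_vol Vu))).
by rewrite mulrA -mulrDl; congr (_ * _); rewrite [_ * logvol' u]mulrC.
Qed.

Lemma derive1n_vol0 k : vol^`(k.+1) 0 = eval_logvol (vol_exp k) 0.
Proof. by rewrite derive1n_vol ?vol0 ?mulr1 //; exact: volU0. Qed.

End MetricJets.

(** * Curvature of the ambient metric *)

Section Slices.
Variables (R : realType) (n : nat).

(** A partial derivative sees only the values on one line, so the two limits are those of the same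
    quotient and no differentiability is required. *)
Lemma partial_slice m m' (f : 'rV[R]_m -> R) (h : 'rV[R]_m' -> R) i i' x x' :
  (forall t, f (t *: delta_mx 0 i + x) = h (t *: delta_mx 0 i' + x')) ->
  partial i f x = partial i' h x'.
Proof.
move=> fh; suff E : (fun t : R => t^-1 *: ((f \o shift x) (t *: delta_mx 0 i) - f x)) =
    (fun t => t^-1 *: ((h \o shift x') (t *: delta_mx 0 i') - h x')).
  by rewrite /partial /derive E.
by apply/funext => t /=; rewrite fh; have := fh 0; rewrite !scale0r !add0r => ->.
Qed.

Lemma partial_line m (f : 'rV[R]_m -> R) (h : R -> R) i x u :
  (forall t, f (t *: delta_mx 0 i + x) = h (t + u)) -> partial i f x = h^`() u.
Proof.
move=> fh; suff E : (fun t : R => t^-1 *: ((f \o shift x) (t *: delta_mx 0 i) - f x)) =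
    (fun t => t^-1 *: (h (t + u) - h u)) by rewrite /partial /derive /derive1 E.
by apply/funext => t /=; rewrite fh; have := fh 0; rewrite scale0r !add0r => ->.
Qed.

Lemma derivable_line m (f : 'rV[R]_m -> R) (h : R -> R) i x u :
  (forall t, f (t *: delta_mx 0 i + x) = h (t + u)) ->
  derivable f x (delta_mx 0 i) -> derivable h u 1.
Proof.
move=> fh; suff E : (fun t : R => t^-1 *: ((f \o shift x) (t *: delta_mx 0 i) - f x)) =
    (fun t => t^-1 *: ((h \o shift u) t%:A - h u)) by rewrite /derivable E.
apply/funext => t /=; rewrite fh [_%:A]mulr1; have := fh 0.
by rewrite scale0r !add0r => ->.
Qed.

Lemma partial_eq_near m (f h : 'rV[R]_m -> R) i x :
  (\forall y \near x, f y = h y) -> partial i f x = partial i h x.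
Proof. exact: near_eq_derive. Qed.

Lemma partial_cst m (f : 'rV[R]_m -> R) (a : R) i x :
  (forall y, f y = a) -> partial i f x = 0.
Proof.
move=> fa; have -> : f = cst a by apply/funext.
by rewrite /partial derive_cst.
Qed.

Definition idx_v : 'I_(1 + (n + 1)) := lshift (n + 1) ord0.
Notation xx := (@idx_x n).
Notation oo := (idx_oo n).

Lemma amb_sum (F : 'I_(1 + (n + 1)) -> R) :
  \sum_a F a = F idx_v + (\sum_i F (xx i) + F oo).
Proof. by rewrite big_split_ord big_ord1 big_split_ord big_ord1. Qed.

Lemma amb_idxP (P : 'I_(1 + (n + 1)) -> Prop) :
  P idx_v -> (forall i, P (xx i)) -> P oo -> forall a, P a.
Proof.
move=> Pv Px Po a; case: (split_ordP a) => b ->; first by rewrite ord1.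
case: (split_ordP b) => e ->; first exact: Px.
by rewrite ord1.
Qed.

Lemma amb_pointE (z : 'rV[R]_(1 + (n + 1))) : z = amb_point (amb_v z) (amb_x z) (amb_u z).
Proof.
by rewrite /amb_point /amb_v /amb_x /amb_u -!mx11_scalar !hsubmxK.
Qed.

Lemma amb_v_point (v : R) (x : 'rV[R]_n) u : amb_v (amb_point v x u) = v.
Proof. by rewrite /amb_v row_mxKl mxE eqxx mulr1n. Qed.

Lemma amb_x_point (v : R) (x : 'rV[R]_n) u : amb_x (amb_point v x u) = x.
Proof. by rewrite /amb_x row_mxKr row_mxKl. Qed.

Lemma amb_u_point (v : R) (x : 'rV[R]_n) u : amb_u (amb_point v x u) = u.
Proof. by rewrite /amb_u !row_mxKr mxE eqxx mulr1n. Qed.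

Lemma amb_point_entryv (v : R) (x : 'rV[R]_n) u : amb_point v x u 0 idx_v = v.
Proof. by rewrite row_mxEl mxE eqxx mulr1n. Qed.

Lemma amb_point_entryx (v : R) (x : 'rV[R]_n) u i : amb_point v x u 0 (xx i) = x 0 i.
Proof. by rewrite row_mxEr row_mxEl. Qed.

Lemma amb_point_entryu (v : R) (x : 'rV[R]_n) u : amb_point v x u 0 oo = u.
Proof. by rewrite row_mxEr row_mxEr mxE eqxx mulr1n. Qed.

Lemma eq_xx i j : (xx i == xx j) = (i == j).
Proof. by rewrite eq_rshift eq_lshift. Qed.

Lemma eq_v_xx i : (idx_v == xx i) = false.
Proof. by rewrite eq_lrshift. Qed.

Lemma eq_xx_v i : (xx i == idx_v) = false.
Proof. by rewrite eq_rlshift. Qed.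

Lemma eq_v_oo : (idx_v == oo) = false.
Proof. by rewrite eq_lrshift. Qed.

Lemma eq_oo_v : (oo == idx_v) = false.
Proof. by rewrite eq_rlshift. Qed.

Lemma eq_xx_oo i : (xx i == oo) = false.
Proof. by rewrite eq_rshift eq_lrshift. Qed.

Lemma eq_oo_xx i : (oo == xx i) = false.
Proof. by rewrite eq_rshift eq_rlshift. Qed.

Definition eq_idx := (eq_xx, eq_v_xx, eq_xx_v, eq_v_oo, eq_oo_v, eq_xx_oo, eq_oo_xx, eqxx).

Lemma delta_entry m (i j : 'I_m) : (delta_mx 0 i : 'rV[R]_m) 0 j = (j == i)%:R.
Proof. by rewrite mxE eqxx. Qed.

Definition amb_entry :=
  (amb_point_entryv, amb_point_entryx, amb_point_entryu, delta_entry, eq_idx).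

Lemma addrow_entry m (t : R) (y z : 'rV[R]_m) i : (t *: y + z) 0 i = t * y 0 i + z 0 i.
Proof. by rewrite !mxE. Qed.

Lemma amb_shift_v t (v : R) (x : 'rV[R]_n) u :
  t *: delta_mx 0 idx_v + amb_point v x u = amb_point (t + v) x u.
Proof.
apply/rowP; apply: amb_idxP => [|i|]; rewrite addrow_entry !amb_entry;
  by rewrite ?mulr1 ?mulr0 ?add0r.
Qed.

Lemma amb_shift_x t (v : R) (x : 'rV[R]_n) u i :
  t *: delta_mx 0 (xx i) + amb_point v x u = amb_point v (t *: delta_mx 0 i + x) u.
Proof.
apply/rowP; apply: amb_idxP => [|j|]; rewrite addrow_entry !amb_entry;
  by rewrite ?mulr1 ?mulr0 ?add0r // addrow_entry delta_entry.
Qed.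

Lemma amb_shift_oo t (v : R) (x : 'rV[R]_n) u :
  t *: delta_mx 0 oo + amb_point v x u = amb_point v x (t + u).
Proof.
apply/rowP; apply: amb_idxP => [|i|]; rewrite addrow_entry !amb_entry;
  by rewrite ?mulr1 ?mulr0 ?add0r.
Qed.

Implicit Types f : 'rV[R]_(1 + (n + 1)) -> R.

Lemma partial_v f v x u :
  partial idx_v f (amb_point v x u) = (fun v => f (amb_point v x u))^`() v.
Proof. by apply: partial_line => t; rewrite amb_shift_v. Qed.

Lemma partial_xx f v x u i :
  partial (xx i) f (amb_point v x u) = partial i (fun x => f (amb_point v x u)) x.
Proof. by apply: partial_slice => t; rewrite amb_shift_x. Qed.

Lemma partial_oo f v x u :
  partial oo f (amb_point v x u) = (fun u => f (amb_point v x u))^`() u.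
Proof. by apply: partial_line => t; rewrite amb_shift_oo. Qed.

(* 2 du dv + A *)
Definition ambM (A : 'M[R]_n) : 'M[R]_(1 + (n + 1)) :=
  block_mx 0 (row_mx 0 1%:M) (col_mx 0 1%:M) (block_mx A 0 0 0).

Lemma ambM_v A a : ambM A idx_v a = (a == oo)%:R.
Proof.
apply: (amb_idxP (P := fun a => ambM A idx_v a = (a == oo)%:R)) => [|i|];
  rewrite eq_idx ?block_mxEul ?block_mxEur ?row_mxEl ?row_mxEr !mxE //.
Qed.

Lemma ambM_oo A a : ambM A oo a = (a == idx_v)%:R.
Proof.
apply: (amb_idxP (P := fun a => ambM A oo a = (a == idx_v)%:R)) => [|i|]; rewrite eq_idx.
- by rewrite block_mxEdl col_mxEd mxE.
- by rewrite block_mxEdr block_mxEdl mxE.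
- by rewrite block_mxEdr block_mxEdr mxE.
Qed.

Lemma ambM_xx A i j : ambM A (xx i) (xx j) = A i j.
Proof. by rewrite block_mxEdr block_mxEul. Qed.

Lemma ambM_xv A i : ambM A (xx i) idx_v = 0.
Proof. by rewrite block_mxEdl col_mxEu mxE. Qed.

Lemma ambM_xo A i : ambM A (xx i) oo = 0.
Proof. by rewrite block_mxEdr block_mxEur mxE. Qed.

Lemma ambM_sumv A F : \sum_a ambM A idx_v a * F a = F oo.
Proof.
rewrite amb_sum !ambM_v !eq_idx mul0r add0r mul1r big1 ?add0r // => i _.
by rewrite ambM_v eq_idx mul0r.
Qed.

Lemma ambM_sumo A F : \sum_a ambM A oo a * F a = F idx_v.
Proof.
rewrite amb_sum !ambM_oo !eq_idx mul0r mul1r big1 ?addr0 // => i _.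
by rewrite ambM_oo eq_idx mul0r.
Qed.

Lemma ambM_sumx A F i : \sum_a ambM A (xx i) a * F a = \sum_j A i j * F (xx j).
Proof.
rewrite amb_sum ambM_xv ambM_xo !mul0r add0r addr0.
by apply: eq_bigr => j _; rewrite ambM_xx.
Qed.

Lemma ambM_mul A C : A *m C = 1%:M -> ambM A *m ambM C = 1%:M.
Proof.
move=> AC; apply/matrixP => a b; rewrite mxE [RHS]mxE; move: a.
apply: amb_idxP => [|i|].
- by rewrite ambM_sumv ambM_oo eq_sym.
- rewrite ambM_sumx; move: b; apply: amb_idxP => [|j|].
  + by rewrite big1 ?eq_idx // => j _; rewrite ambM_xv mulr0.
  + rewrite eq_idx; have := congr1 (fun B : 'M[R]_n => B i j) AC; rewrite !mxE => <-.
    by apply: eq_bigr => k _; rewrite ambM_xx.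
  + by rewrite big1 ?eq_idx // => j _; rewrite ambM_xo mulr0.
- by rewrite ambM_sumo ambM_v eq_sym.
Qed.

Lemma invmx_unique m (A C : 'M[R]_m) : A *m C = 1%:M -> invmx A = C.
Proof.
move=> AC; have [uA _] := mulmx1_unit AC.
by rewrite -[RHS](mulKmx uA) AC mulmx1.
Qed.

Lemma ambM_inv A : A \in unitmx -> invmx (ambM A) = ambM (invmx A).
Proof. by move=> uA; apply/invmx_unique/ambM_mul/mulmxV. Qed.

Lemma ambM_unit A : A \in unitmx -> ambM A \in unitmx.
Proof. by move=> uA; have [] := mulmx1_unit (ambM_mul (mulmxV uA)). Qed.

End Slices.

(** * Ricci curvature as a trace, and locality of the curvature *)

Section Locality.
Variables (R : realType) (m : nat).
Implicit Types (G : 'rV[R]_m -> 'M[R]_m) (f : 'rV[R]_m -> R).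

(** The inverse metric cancels the metric that lowered the index in [riemann], leaving an expression
    in Christoffel symbols alone. *)
Lemma ricci_trace G x j l : G x \in unitmx ->
  ricci G j l x = \sum_i curvature_op G i i j l x.
Proof.
move=> uG; apply: eq_bigr => i _.
under eq_bigr do rewrite mulr_sumr; rewrite exchange_big /=.
transitivity (\sum_p (1%:M : 'M[R]_m) i p * curvature_op G p i j l x).
  rewrite -(mulVmx uG); apply: eq_bigr => p _; rewrite mxE mulr_suml.
  by apply: eq_bigr => k _; rewrite mulrA.
rewrite (bigD1 i) //= mxE eqxx mul1r big1 ?addr0 // => p pi.
by rewrite mxE eq_sym (negbTE pi) mul0r.
Qed.

Variable D : set 'rV[R]_m.
Hypothesis D_open : open D.

Lemma partial_eq_on f h i x : (forall y, D y -> f y = h y) -> D x ->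
  partial i f x = partial i h x.
Proof.
move=> fh Dx; apply: partial_eq_near; apply: filterS fh _.
exact: open_nbhs_nbhs.
Qed.

Lemma christoffel_eq_on G H k i j x : (forall y, D y -> G y = H y) -> D x ->
  christoffel G k i j x = christoffel H k i j x.
Proof.
move=> GH Dx; rewrite /christoffel GH //; congr (_ * _); apply: eq_bigr => l _.
have E a b c : partial a (fun y => G y b c) x = partial a (fun y => H y b c) x.
  by apply: partial_eq_on => // y /GH ->.
by rewrite !E.
Qed.

Lemma curvature_op_eq_on G H l i j k x : (forall y, D y -> G y = H y) -> D x ->
  curvature_op G l i j k x = curvature_op H l i j k x.
Proof.
move=> GH Dx; have E a b c y : D y -> christoffel G a b c y = christoffel H a b c y.
  exact: christoffel_eq_on.
have Ep a b c d :
    partial a (christoffel G b c d) x = partial a (christoffel H b c d) x.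
  by apply: partial_eq_on => // y; apply: E.
rewrite /curvature_op !Ep; congr (_ + _).
by apply: eq_bigr => p _; rewrite !E.
Qed.

End Locality.

(** * Christoffel symbols, curvature and weighted quantities of 2 du dv + A_u *)

Section AmbientGeometry.
Variables (R : realType) (n : nat) (A : R -> 'rV[R]_n -> 'M[R]_n).
(** [good x u] describes where the family consists of metrics; nothing is assumed about [A]
    elsewhere. [good_near] expresses that this domain is open, which lets identities on it be
    differentiated. *)
Variable good : 'rV[R]_n -> R -> Prop.
Hypothesis A_sym : forall x u, good x u -> (A u x)^T = A u x.
Hypothesis A_unit : forall x u, good x u -> A u x \in unitmx.
Hypothesis good_near : forall v x u, good x u ->
  \forall z \near amb_point v x u, good (amb_x z) (amb_u z).

Notation iv := (@idx_v n).
Notation xx := (@idx_x n).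
Notation oo := (idx_oo n).

Let G z := ambM (A (amb_u z) (amb_x z)).
Let chr := christoffel G.

Definition dA u x : 'M[R]_n := \matrix_(i, j) (fun u => A u x i j)^`() u.
Definition shapeA u x : 'M[R]_n := 2^-1 *: (invmx (A u x) *m dA u x).

Lemma ambM_av (C : 'M[R]_n) a : ambM C a iv = (a == oo)%:R.
Proof.
apply: (amb_idxP (P := fun a => ambM C a iv = (a == oo)%:R)) => [|i|].
- by rewrite ambM_v !eq_idx.
- by rewrite ambM_xv !eq_idx.
- by rewrite ambM_oo !eq_idx.
Qed.

Lemma ambM_ao (C : 'M[R]_n) a : ambM C a oo = (a == iv)%:R.
Proof.
apply: (amb_idxP (P := fun a => ambM C a oo = (a == iv)%:R)) => [|i|].
- by rewrite ambM_v !eq_idx.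
- by rewrite ambM_xo !eq_idx.
- by rewrite ambM_oo !eq_idx.
Qed.

Lemma partial_Gv k a z : partial k (fun y => G y iv a) z = 0.
Proof. by apply: partial_cst => y; apply: ambM_v. Qed.

Lemma partial_Gav k a z : partial k (fun y => G y a iv) z = 0.
Proof. by apply: partial_cst => y; apply: ambM_av. Qed.

Lemma partial_Go k a z : partial k (fun y => G y oo a) z = 0.
Proof. by apply: partial_cst => y; apply: ambM_oo. Qed.

Lemma partial_Gao k a z : partial k (fun y => G y a oo) z = 0.
Proof. by apply: partial_cst => y; apply: ambM_ao. Qed.

Lemma G_point v x u : G (amb_point v x u) = ambM (A u x).
Proof. by rewrite /G amb_u_point amb_x_point. Qed.

Lemma partial_vG a b z : partial iv (fun y => G y a b) z = 0.
Proof.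
rewrite [z]amb_pointE partial_v; apply: derive1_val.
by under eq_fun do rewrite G_point; apply: is_derive_cst.
Qed.

Definition partial_G := (partial_Gv, partial_Gav, partial_Go, partial_Gao, partial_vG).

Lemma partial_xG k i j v x u :
  partial (xx k) (fun y => G y (xx i) (xx j)) (amb_point v x u)
  = partial k (fun y => A u y i j) x.
Proof. by rewrite partial_xx; under eq_fun do rewrite G_point ambM_xx. Qed.

Lemma partial_oG i j v x u :
  partial oo (fun y => G y (xx i) (xx j)) (amb_point v x u) = dA u x i j.
Proof. by rewrite partial_oo mxE; under eq_fun do rewrite G_point ambM_xx. Qed.

Lemma dA_sym x u : good x u -> (dA u x)^T = dA u x.
Proof.
move=> gxu; apply/matrixP => i j; rewrite mxE -!(partial_oG _ _ 0).
apply: partial_eq_near; apply: filterS (good_near 0 gxu) => z /A_sym Az.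
by rewrite /G !ambM_xx -{1}Az mxE.
Qed.

(** The field d_v is parallel: the entries of the metric in the row v are constant and no entry
    depends on v. *)
Lemma chr_v1 k b z : chr k iv b z = 0.
Proof. by rewrite /chr /christoffel big1 ?mulr0 // => l _; rewrite !partial_G addr0 subr0 mulr0. Qed.

Lemma chr_v2 k b z : chr k b iv z = 0.
Proof. by rewrite /chr /christoffel big1 ?mulr0 // => l _; rewrite !partial_G addr0 subr0 mulr0. Qed.

(** The u-lines are geodesics. Consequently the indices oo of an iterated covariant derivative along
    oo produce no correction terms. *)
Lemma chr_oo k z : chr k oo oo z = 0.
Proof. by rewrite /chr /christoffel big1 ?mulr0 // => l _; rewrite !partial_G addr0 subr0 mulr0. Qed.

Section Point.
Variables (v : R) (x : 'rV[R]_n) (u : R).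
Hypothesis gxu : good x u.
Notation z0 := (amb_point v x u).

Lemma G_unit : G z0 \in unitmx.
Proof. by rewrite G_point ambM_unit // A_unit. Qed.

Lemma invG : invmx (G z0) = ambM (invmx (A u x)).
Proof. by rewrite G_point ambM_inv // A_unit. Qed.

Lemma chr_up_oo a b : chr oo a b z0 = 0.
Proof. by rewrite /chr /christoffel invG ambM_sumo !partial_G addr0 subr0 mulr0. Qed.

Lemma chr_v_ox i : chr iv oo (xx i) z0 = 0.
Proof. by rewrite /chr /christoffel invG ambM_sumv !partial_G addr0 subr0 mulr0. Qed.

Lemma chr_v_xx i j : chr iv (xx i) (xx j) z0 = - (2^-1 * dA u x i j).
Proof.
by rewrite /chr /christoffel invG ambM_sumv !partial_G partial_oG add0r sub0r mulrN.
Qed.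

Lemma chr_x_ox k i : chr (xx k) oo (xx i) z0 = shapeA u x k i.
Proof.
rewrite /chr /christoffel invG ambM_sumx !mxE; congr (_ * _).
by apply: eq_bigr => j _; rewrite !partial_G partial_oG addr0 subr0 -{1}(dA_sym gxu) mxE.
Qed.

Lemma chr_x_xo k i : chr (xx k) (xx i) oo z0 = shapeA u x k i.
Proof.
rewrite /chr /christoffel invG ambM_sumx !mxE; congr (_ * _).
by apply: eq_bigr => j _; rewrite !partial_G partial_oG add0r subr0 -{1}(dA_sym gxu) mxE.
Qed.

Lemma chr_xxx k i j : chr (xx k) (xx i) (xx j) z0 = christoffel (A u) k i j x.
Proof.
rewrite /chr /christoffel invG ambM_sumx; congr (_ * _).
by apply: eq_bigr => l _; rewrite !partial_xG.
Qed.

Lemma partial_chr_eq a k b c f :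
  (forall v x u, good x u -> chr k b c (amb_point v x u) = f (amb_point v x u)) ->
  partial a (chr k b c) z0 = partial a f z0.
Proof.
move=> cf; apply: partial_eq_near; apply: filterS (good_near v gxu) => z gz.
by rewrite [z]amb_pointE cf.
Qed.

Lemma partial_chr0 a k b c :
  (forall v x u, good x u -> chr k b c (amb_point v x u) = 0) ->
  partial a (chr k b c) z0 = 0.
Proof. by move=> c0; rewrite (@partial_chr_eq a k b c (cst 0)) // /partial derive_cst. Qed.

End Point.

Definition chr0 := (chr_v1, chr_v2, chr_oo).
(* Otherwise unification compares Christoffel symbols by unfolding them. *)
#[local] Opaque christoffel partial idx_x idx_oo idx_v.

Lemma partial_chr_v1 v x u a k b : good x u -> partial a (chr k iv b) (amb_point v x u) = 0.
Proof. by move=> gxu; apply: partial_chr0 => // *; apply: chr_v1. Qed.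

Lemma partial_chr_oo v x u a k : good x u -> partial a (chr k oo oo) (amb_point v x u) = 0.
Proof. by move=> gxu; apply: partial_chr0 => // *; apply: chr_oo. Qed.

Lemma partial_chr_up_oo v x u a b c :
  good x u -> partial a (chr oo b c) (amb_point v x u) = 0.
Proof. by move=> gxu; apply: partial_chr0 => // *; apply: chr_up_oo. Qed.

Lemma partial_v_chr_v_xx v x u i j :
  good x u -> partial iv (chr iv (xx i) (xx j)) (amb_point v x u) = 0.
Proof.
move=> gxu; rewrite partial_v; apply: derive1_val.
by under eq_fun do rewrite chr_v_xx //; apply: is_derive_cst.
Qed.

Lemma partial_x_chr_xxx v x u l k i j : good x u ->
  partial (xx l) (chr (xx k) (xx i) (xx j)) (amb_point v x u)
  = partial l (christoffel (A u) k i j) x.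
Proof.
move=> gxu.
transitivity (partial (xx l) (fun z => christoffel (A (amb_u z)) k i j (amb_x z))
  (amb_point v x u)).
  by apply: partial_chr_eq => [//|? ? ? ?]; rewrite chr_xxx // amb_u_point amb_x_point.
by rewrite partial_xx; under eq_fun do rewrite amb_u_point amb_x_point.
Qed.

Lemma partial_o_chr_xxo v x u k i : good x u ->
  partial oo (chr (xx k) (xx i) oo) (amb_point v x u)
  = (fun u => shapeA u x k i)^`() u.
Proof.
move=> gxu.
transitivity (partial oo (fun z => shapeA (amb_u z) (amb_x z) k i) (amb_point v x u)).
  by apply: partial_chr_eq => [//|? ? ? ?]; rewrite chr_x_xo // amb_u_point amb_x_point.
by rewrite partial_oo; under eq_fun do rewrite amb_u_point amb_x_point.
Qed.

Lemma chr_sum_oo v x u k i l : good x u ->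
  \sum_p (chr (xx k) oo p (amb_point v x u) * chr p (xx i) oo (amb_point v x u)
    - chr (xx k) l p (amb_point v x u) * chr p oo oo (amb_point v x u))
  = (shapeA u x *m shapeA u x) k i.
Proof.
move=> gxu; rewrite amb_sum !chr0 !mul0r !mulr0 subrr add0r addr0 mxE.
by apply: eq_bigr => j _; rewrite chr_oo mulr0 subr0 chr_x_ox // chr_x_xo.
Qed.

Lemma curvature_oxo v x u k i : good x u ->
  curvature_op G (xx k) oo (xx i) oo (amb_point v x u)
  = (fun u => shapeA u x k i)^`() u + (shapeA u x *m shapeA u x) k i.
Proof.
move=> gxu; rewrite /curvature_op -/chr partial_o_chr_xxo // partial_chr_oo // subr0.
by rewrite chr_sum_oo.
Qed.

Lemma curvature_v v x u b c : good x u ->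
  partial iv (chr iv b c) (amb_point v x u) = 0 ->
  curvature_op G iv iv b c (amb_point v x u) = 0.
Proof.
move=> gxu c0; rewrite /curvature_op -/chr c0 partial_chr_v1 // subrr add0r big1 // => p _.
by rewrite !chr0 mul0r mulr0 subrr.
Qed.

Lemma curvature_o v x u b c : good x u ->
  curvature_op G oo oo b c (amb_point v x u) = 0.
Proof.
move=> gxu; rewrite /curvature_op -/chr !partial_chr_up_oo // subrr add0r big1 // => p _.
by rewrite !chr_up_oo // !mul0r subrr.
Qed.

Lemma curvature_x_oo v x u i : good x u ->
  curvature_op G (xx i) (xx i) oo oo (amb_point v x u)
  = - ((fun u => shapeA u x i i)^`() u + (shapeA u x *m shapeA u x) i i).
Proof.
move=> gxu; rewrite /curvature_op -/chr partial_chr_oo // partial_o_chr_xxo //.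
rewrite sub0r opprD; congr (_ + _); rewrite -(chr_sum_oo v i i (xx i) gxu) -sumrN.
by apply: eq_bigr => p _; rewrite opprB.
Qed.

Lemma curvature_x_xx v x u i j k : good x u ->
  curvature_op G (xx k) (xx k) (xx i) (xx j) (amb_point v x u)
  = curvature_op (A u) k k i j x.
Proof.
move=> gxu; rewrite /curvature_op -/chr !partial_x_chr_xxx //; congr (_ + _).
rewrite amb_sum !chr0 !mul0r subrr add0r !(chr_up_oo v gxu) !mulr0 subrr addr0.
by apply: eq_bigr => p _; rewrite !(chr_xxx v gxu).
Qed.

Lemma ricci_oo v x u : good x u ->
  ricci G oo oo (amb_point v x u)
  = - \sum_i ((fun u => shapeA u x i i)^`() u + (shapeA u x *m shapeA u x) i i).
Proof.
move=> gxu; rewrite ricci_trace ?G_unit // amb_sum curvature_v ?partial_chr_oo //.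
rewrite curvature_o // add0r addr0 -sumrN; apply: eq_bigr => i _.
exact: curvature_x_oo.
Qed.

(** The second fundamental form does not appear: a lower index v or an upper index oo makes a
    Christoffel symbol vanish, so every product passing through v or oo drops out and only the
    curvature of A_u remains. *)
Lemma ricci_xx v x u i j : good x u ->
  ricci G (xx i) (xx j) (amb_point v x u)
  = \sum_k curvature_op (A u) k k i j x.
Proof.
move=> gxu; rewrite ricci_trace ?G_unit // amb_sum curvature_v ?partial_v_chr_v_xx //.
rewrite curvature_o // add0r addr0; apply: eq_bigr => k _.
exact: curvature_x_xx.
Qed.

Variables (ps : R -> 'rV[R]_n -> R) (lam : R).

Let f (z : 'rV[R]_(1 + (n + 1))) : R :=
  ps (amb_u z) (amb_x z) - amb_v z + lam * amb_u z * amb_v z.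

Lemma is_derive_addl (h : R -> R) (b u dh : R) : is_derive u 1 h dh ->
  is_derive u 1 (fun t => h t + b * t) (dh + b).
Proof.
move=> Dh; have Db := is_derive_mulr (is_derive_cst b u 1) (is_derive_id u 1).
by apply: (is_derive_eq (is_deriveD Dh Db)); rewrite mul0r add0r mulr1.
Qed.

Lemma f_point v x u : f (amb_point v x u) = ps u x - v + lam * u * v.
Proof. by rewrite /f amb_u_point amb_x_point amb_v_point. Qed.

Lemma f_point0 x u : f (amb_point 0 x u) = ps u x.
Proof. by rewrite f_point subr0 mulr0 addr0. Qed.

Lemma partial_v_f v x u : partial iv f (amb_point v x u) = lam * u - 1.
Proof.
rewrite partial_v; under eq_fun do rewrite f_point.
have -> : (fun v => ps u x - v + lam * u * v) = (fun v => ps u x + (lam * u - 1) * v).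
  by apply/funext => w; ring.
by rewrite (derive1_val (is_derive_addl _ (is_derive_cst _ _ _))) add0r.
Qed.

Lemma partial_x_f x u i : partial (xx i) f (amb_point 0 x u) = partial i (ps u) x.
Proof. by rewrite partial_xx; under eq_fun do rewrite f_point0. Qed.

Lemma partial_oo_f0 x u :
  partial oo f (amb_point 0 x u) = (fun u => ps u x)^`() u.
Proof. by rewrite partial_oo; under eq_fun do rewrite f_point0. Qed.

(** Values v != 0 are needed for the mixed Hessian. There the term lam u v has to be split off,
    which calls for differentiability of the family in u. *)
Lemma partial_oo_f v x : derivable (fun u => ps u x) 0 1 ->
  partial oo f (amb_point v x 0) = (fun u => ps u x)^`() 0 + lam * v.
Proof.
move=> /is_derive1 Dps; rewrite partial_oo; under eq_fun do rewrite f_point.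
have -> : (fun u => ps u x - v + lam * u * v) = (fun u => (ps u x - v) + (lam * v) * u).
  by apply/funext => w; ring.
by rewrite (derive1_val (is_derive_addl _ (is_deriveB Dps (is_derive_cst v (0 : R) 1)))) subr0.
Qed.

Lemma hessian_oo x u : hessian G f oo oo (amb_point 0 x u) = (fun u => ps u x)^`(2) u.
Proof.
rewrite /hessian big1 => [|a _]; last by rewrite -/chr chr_oo mul0r.
by rewrite subr0 partial_oo; under eq_fun do rewrite partial_oo_f0.
Qed.

Lemma hessian_v_oo x : derivable (fun u => ps u x) 0 1 ->
  hessian G f iv oo (amb_point 0 x 0) = lam.
Proof.
move=> Dps; rewrite /hessian big1 => [|a _]; last by rewrite -/chr chr_v1 mul0r.
rewrite subr0 partial_v; under eq_fun do rewrite partial_oo_f //.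
by rewrite (derive1_val (is_derive_addl _ (is_derive_cst _ _ _))) add0r.
Qed.

Lemma hessian_oo_v v x u : hessian G f oo iv (amb_point v x u) = lam.
Proof.
rewrite /hessian big1 => [|a _]; last by rewrite -/chr chr_v2 mul0r.
rewrite subr0 partial_oo; under eq_fun do rewrite partial_v_f.
under eq_fun do rewrite addrC.
by rewrite (derive1_val (is_derive_addl _ (is_derive_cst _ _ _))) add0r.
Qed.

(** The additional term is - Gamma^v_ij d_v f with Gamma^v_ij = - g'_ij / 2 and d_v f = lam u - 1.
    At u = 0 it equals - g'_ij / 2, which is how g' becomes tied to P. *)
Lemma hessian_xx x u i j : good x u ->
  hessian G f (xx i) (xx j) (amb_point 0 x u)
  = hessian (A u) (ps u) i j x + 2^-1 * dA u x i j * (lam * u - 1).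
Proof.
move=> gxu; rewrite /hessian partial_xx; under eq_fun do rewrite partial_x_f.
rewrite amb_sum -/chr chr_v_xx // chr_up_oo // mul0r addr0 partial_v_f.
rewrite opprD mulNr opprK addrCA [RHS]addrC; congr (_ + (_ - _)).
by apply: eq_bigr => k _; rewrite chr_xxx // partial_x_f.
Qed.

Lemma P_phi_oo x u : good x u ->
  P_phi G f lam oo oo (amb_point 0 x u) = (fun u => ps u x)^`(2) u
   - \sum_i ((fun u => shapeA u x i i)^`() u + (shapeA u x *m shapeA u x) i i).
Proof.
move=> gxu; rewrite /P_phi ricci_oo // hessian_oo G_point ambM_oo eq_idx mulr0 subr0.
by rewrite addrC.
Qed.

Lemma P_phi_xx x i j : good x 0 ->
  P_phi G f lam (xx i) (xx j) (amb_point 0 x 0) =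
  P_phi (A 0) (ps 0) lam i j x - 2^-1 * dA 0 x i j.
Proof.
move=> gx; rewrite /P_phi ricci_xx // hessian_xx // G_point ambM_xx.
rewrite ricci_trace ?A_unit //; ring.
Qed.

(** The two mixed Hessian entries contribute 2 lam and reduce - (n + 2) lam to - n lam. The gradient
    contributes 2 f_v f_u = - 2 phi', hence the leading term 2 phi'. *)
Lemma F_phi_point x : good x 0 -> derivable (fun u => ps u x) 0 1 ->
  F_phi G f lam (amb_point 0 x 0) =
    2 * (fun u => ps u x)^`() 0 - grad_sqnorm (A 0) (ps 0) x
    + (laplacian (A 0) (ps 0) x
       - \sum_i \sum_j invmx (A 0 x) i j * (2^-1 * dA 0 x i j))
    + 2 * lam * ps 0 x - n%:R * lam.
Proof.
move=> gx Dps; rewrite /F_phi f_point0.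
have -> : laplacian G f (amb_point 0 x 0) = 2 * lam + (laplacian (A 0) (ps 0) x
    - \sum_i \sum_j invmx (A 0 x) i j * (2^-1 * dA 0 x i j)).
  rewrite /laplacian (invG 0 gx) amb_sum ambM_sumv ambM_sumo.
  rewrite (hessian_v_oo Dps) hessian_oo_v addrC -addrA mulr2n mulrDl mul1r addrC.
  congr (_ + _); rewrite -sumrB; apply: eq_bigr => i _; rewrite ambM_sumx -sumrB.
  by apply: eq_bigr => j _; rewrite hessian_xx // mulr0 sub0r mulrN1 mulrBr.
have -> : grad_sqnorm G f (amb_point 0 x 0)
    = - 2 * (fun u => ps u x)^`() 0 + grad_sqnorm (A 0) (ps 0) x.
  have E C (H : 'I_(1 + (n + 1)) -> R) a : \sum_b ambM C a b * H a * H b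
      = H a * \sum_b ambM C a b * H b.
    by rewrite mulr_sumr; apply: eq_bigr => b _; rewrite mulrAC mulrC.
  rewrite /grad_sqnorm invG // (eq_bigr _ (fun a _ => E _ (fun a => partial a f _) a)).
  rewrite amb_sum ambM_sumv ambM_sumo partial_v_f partial_oo_f0 mulr0 sub0r.
  rewrite addrCA addrC; congr (_ + _); first by ring.
  apply: eq_bigr => i _; rewrite ambM_sumx mulr_sumr; apply: eq_bigr => j _.
  by rewrite !partial_x_f mulrCA mulrA.
rewrite !natrD; ring.
Qed.

Lemma riemann_oxxo v x u i j : good x u ->
  riemann G oo (xx i) (xx j) oo (amb_point v x u)
  = \sum_k A u x j k *
      ((fun u => shapeA u x k i)^`() u + (shapeA u x *m shapeA u x) k i).
Proof.
move=> gxu; rewrite /riemann G_point ambM_sumx.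
by apply: eq_bigr => k _; rewrite curvature_oxo.
Qed.

Lemma set_nth_nseq (T : Type) (a b c : T) l s p :
  set_nth b (nseq l a ++ s) (l + p) c = nseq l a ++ set_nth b s p c.
Proof. by elim: l => //= l ->. Qed.

(** Of the l + 4 slots, all those carrying oo contribute nothing, since Gamma^c_(oo oo) = 0. The two
    slots tangent to M each contribute a shape operator, because Gamma^c_(oo i) has only components
    along M. *)
Lemma covariant_derivative_oo (T : tensor_field R (1 + (n + 1))) l v x u i j :
  good x u ->
  let t a b := nseq l oo ++ [:: oo; a; b; oo] in
  covariant_derivative G T (oo :: t (xx i) (xx j)) (amb_point v x u)
  = (fun u => T (t (xx i) (xx j)) (amb_point v x u))^`() u
    - (\sum_k shapeA u x k i * T (t (xx k) (xx j)) (amb_point v x u)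
       + \sum_k shapeA u x k j * T (t (xx i) (xx k)) (amb_point v x u)).
Proof.
move=> gxu t; rewrite /= partial_oo; congr (_ - _).
have size_t : size (t (xx i) (xx j)) = (l + 4)%N by rewrite size_cat size_nseq.
rewrite -(big_mkord predT (fun p => \sum_c christoffel G c oo
  (nth oo (t (xx i) (xx j)) p) _ * T (set_nth oo (t (xx i) (xx j)) p c) _)).
rewrite size_t big_mkord big_split_ord /= big1 ?add0r; last first.
  move=> p _; rewrite big1 // => c _; rewrite -/chr nth_cat size_nseq ltn_ord.
  by rewrite nth_nseq ltn_ord chr_oo mul0r.
have nthE p : nth oo (t (xx i) (xx j)) (l + p) = nth oo [:: oo; xx i; xx j; oo] p.
  by rewrite nth_cat size_nseq ltnNge leq_addr addKn.
under eq_bigr => p _ do under eq_bigr => c _ do rewrite nthE set_nth_nseq -/chr.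
have sum4 (F : nat -> R) : \sum_(p < 4) F p = F 0%N + (F 1%N + (F 2%N + F 3%N)).
  by rewrite !big_ord_recl big_ord0 addr0.
rewrite (sum4 (fun p => \sum_c chr c oo (nth oo [:: oo; xx i; xx j; oo] p) _
  * T (nseq l oo ++ set_nth oo [:: oo; xx i; xx j; oo] p c) _)) /=.
have sum_oo (F : 'I_(1 + (n + 1)) -> R) : \sum_c chr c oo oo (amb_point v x u) * F c = 0.
  by rewrite big1 // => c _; rewrite chr_oo mul0r.
have sum_ox F k : \sum_c chr c oo (xx k) (amb_point v x u) * F c
    = \sum_m shapeA u x m k * F (xx m).
  rewrite amb_sum chr_v_ox // chr_up_oo // !mul0r add0r addr0.
  by apply: eq_bigr => m _; rewrite chr_x_ox.
by rewrite !sum_oo !sum_ox add0r addr0.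
Qed.

End AmbientGeometry.

(** * The ambient equations along a u-line *)

Section AmbientEquations.
Variables (R : realType) (n : nat).

Notation xx := (@idx_x n).
Notation oo := (idx_oo n).

Lemma O_u_inftyP (h : 'rV[R]_(1 + (n + 1)) -> R) z N : O_u_infty h z ->
  exists C, \forall y \near z, `|h y| <= C * `|amb_u y| ^+ N.
Proof.
move=> /(_ N)/eqO_exP[C _ HC]; exists C.
by apply: filterS HC => y; rewrite normrX.
Qed.

Lemma O_u_infty0 (h : 'rV[R]_(1 + (n + 1)) -> R) v x :
  O_u_infty h (amb_point v x 0) -> h (amb_point v x 0) = 0.
Proof.
move=> /(O_u_inftyP 1)[C /nbhs_singleton]; rewrite amb_u_point normr0 expr1 mulr0.
by rewrite normr_le0 => /eqP.
Qed.

Lemma O_u_infty_line (h : 'rV[R]_(1 + (n + 1)) -> R) v x N :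
  O_u_infty h (amb_point v x 0) ->
  exists C, \forall u \near 0, `|h (amb_point v x u)| <= C * `|u| ^+ N.
Proof.
move=> /(O_u_inftyP N)[C HC]; exists C.
have cont : (fun u => amb_point v x u) @ (0 : R) --> amb_point v x 0.
  have -> : (fun u => amb_point v x u) = (fun u => u *: delta_mx 0 oo + amb_point v x 0).
    by apply/funext => u; rewrite amb_shift_oo addr0.
  have : (fun u : R => u *: delta_mx 0 oo + amb_point v x 0) @ (0 : R)
      --> 0 *: delta_mx 0 oo + amb_point v x 0.
    exact: (cvgD (@scalel_continuous R 'rV[R]_(1 + (n + 1)) _ _) (cvg_cst _)).
  by rewrite scale0r add0r.
have H : \forall u \near (0 : R),
    `|h (amb_point v x u)| <= C * `|amb_u (amb_point v x u)| ^+ N by exact: cont _ HC.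
by near=> u; rewrite -[u in X in _ <= X](amb_u_point v x); near: u; exact: H.
Unshelve. all: by end_near. Qed.

Variables (A : R -> 'rV[R]_n -> 'M[R]_n).
Variable good : 'rV[R]_n -> R -> Prop.
Hypothesis A_sym : forall x u, good x u -> (A u x)^T = A u x.
Hypothesis A_unit : forall x u, good x u -> A u x \in unitmx.
Hypothesis good_near : forall v x u, good x u ->
  \forall z \near amb_point v x u, good (amb_x z) (amb_u z).
Variables (ps : R -> 'rV[R]_n -> R) (lam : R).
Let G z := ambM (A (amb_u z) (amb_x z)).
Let f (z : 'rV[R]_(1 + (n + 1))) : R :=
  ps (amb_u z) (amb_x z) - amb_v z + lam * amb_u z * amb_v z.

Variable x : 'rV[R]_n.
Let U : set R := good x.
Hypothesis U_open : open U.
Hypothesis U0 : U 0.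
Let g u := A u x.
Let phi u := ps u x.
Hypothesis g_smooth : smooth_curve U g.
Hypothesis phi_smooth : smooth_curve U phi.

Let gen := gen g.
Let shape := shape g.

Lemma g_unit u : U u -> g u \in unitmx.
Proof. exact: A_unit. Qed.

Lemma dAE u : U u -> dA A u x = g^`() u.
Proof.
move=> Uu; apply/matrixP => i j; rewrite mxE; apply: derive1_val.
by have /is_derive_mxP := smooth_is_derive g_smooth Uu; apply.
Qed.

Lemma shapeAE u : U u -> shapeA A u x = shape u.
Proof. by move=> Uu; rewrite /shapeA dAE. Qed.

Lemma shapeA_gen1 u : U u ->
  (\matrix_(i, j) (fun u => shapeA A u x i j)^`() u) + shapeA A u x *m shapeA A u x
  = gen 1 u.
Proof.
move=> Uu; rewrite shapeAE //; congr (_ + _); apply/matrixP => i j; rewrite mxE.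
rewrite (@derive1_eq_on _ _ U_open _ _ (fun u => shape u i j)) //; last first.
  by move=> t Ut; rewrite shapeAE.
apply: derive1_val.
by have /is_derive_mxP := smooth_is_derive (smooth_gen U_open g_smooth g_unit 0) Uu; apply.
Qed.

Lemma P_phi_oo_gen u : U u ->
  P_phi G f lam oo oo (amb_point 0 x u) = phi^`(2) u + -1 *: \tr (gen 1 u).
Proof.
move=> Uu; rewrite (P_phi_oo A_sym A_unit good_near) // scaleN1r; congr (_ - _).
by rewrite -shapeA_gen1 //; apply: eq_bigr => i _; rewrite !mxE.
Qed.

(** On the line v = 0 over x, the component (oo, oo) of the ambient tensor is phi'' - tr E_1; it is
    smooth and O(u^oo), hence flat at 0. *)
Lemma phi_flat : O_u_infty (P_phi G f lam oo oo) (amb_point 0 x 0) ->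
  forall j, (fun u => phi^`(2) u + -1 *: \tr (gen 1 u))^`(j) 0 = 0.
Proof.
move=> PO; apply: (flat_derive1n U_open U0).
  apply: smoothD => //; first exact: smooth_derive1n.
  by apply: smoothZ => //; exact: (smooth_trace U_open (smooth_gen U_open g_smooth g_unit 1)).
move=> N; have [C HC] := O_u_infty_line N PO; exists C.
have nU : \forall u \near 0, U u by exact: open_nbhs_nbhs.
near=> u; rewrite -P_phi_oo_gen; [near: u; exact: HC|near: u; exact: nU].
Unshelve. all: by end_near. Qed.

Lemma metric_derive0 :
  (forall i j, O_u_infty (P_phi G f lam (xx i) (xx j)) (amb_point 0 x 0)) ->
  \matrix_(i, j) P_phi (A 0) (ps 0) lam i j x = 2^-1 *: g^`() 0.
Proof.
move=> PO; apply/matrixP => i j; rewrite !mxE -dAE //.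
by have /O_u_infty0/eqP := PO i j; rewrite (P_phi_xx A_unit good_near) // subr_eq0 => /eqP.
Qed.

(** The equation F~ = 0 contains the trace of g'/2, which is tr P = R + Delta phi - n lam. The
    Laplacian and n lam cancel, and 2 phi' = R + |grad phi|^2 - 2 lam phi = - 2 Y remains. *)
Lemma phi_derive0 :
  (forall i j, O_u_infty (P_phi G f lam (xx i) (xx j)) (amb_point 0 x 0)) ->
  O_u_infty (F_phi G f lam) (amb_point 0 x 0) ->
  phi^`() 0 = - Y_phi (A 0) (ps 0) lam x.
Proof.
move=> PO /O_u_infty0; rewrite (F_phi_point A_unit) //; last exact: smooth_derivable phi_smooth U0.
have -> : \sum_i \sum_j invmx (A 0 x) i j * (2^-1 * dA A 0 x i j)
    = scalar_curvature (A 0) x + laplacian (A 0) (ps 0) x - n%:R * lam.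
  have e i j : 2^-1 * dA A 0 x i j = P_phi (A 0) (ps 0) lam i j x.
    have := congr1 (fun B : 'M[R]_n => B i j) (metric_derive0 PO).
    by rewrite mxE -(dAE U0) => ->; rewrite [RHS]mxE.
  have -> : n%:R * lam = \sum_i \sum_j invmx (A 0 x) i j * (lam * A 0 x i j).
    have := congr1 mxtrace (mulVmx (A_unit U0)); rewrite mxtrace1 => <-.
    rewrite mulr_suml; apply: eq_bigr => i _; rewrite mxE mulr_suml.
    by apply: eq_bigr => j _; rewrite -{2}(A_sym U0) mxE mulrAC mulrA mulrC mulrA.
  rewrite -big_split -sumrB; apply: eq_bigr => i _ /=.
  rewrite -big_split -sumrB; apply: eq_bigr => j _ /=.
  by rewrite e /P_phi mulrBr mulrDr.
move=> H; rewrite /Y_phi; apply: (@mulfI _ 2); first by rewrite pnatr_eq0.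
rewrite mulrN mulNr mulrN opprK mulrA divff ?pnatr_eq0 // mul1r.
move: H; rewrite -/phi.
set a := phi^`() 0; set b := grad_sqnorm _ _ _; set c := laplacian _ _ _.
set d := scalar_curvature _ _; set e := ps 0 x => H.
have -> : 2 * a = 2 * a - b + (c - (d + c - n%:R * lam)) + 2 * lam * e - n%:R * lam
   + (d + b - 2 * lam * e) by ring.
by rewrite H add0r.
Qed.

Lemma g_sym u : U u -> (g u)^T = g u.
Proof. exact: A_sym. Qed.

Lemma dg_sym u : U u -> (g^`() u)^T = g^`() u.
Proof. by move=> Uu; rewrite -dAE // (dA_sym A_sym good_near). Qed.

Lemma ddg_sym u : U u -> (g^`()^`() u)^T = g^`()^`() u.
Proof.
move=> Uu; have := is_derive_trmx (smooth_is_derive (smooth_derive1 g_smooth) Uu).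
by move/derive1_val => <-; apply: (derive1_eq_on U_open) Uu => t Ut; apply: dg_sym.
Qed.

Lemma g_shape u : U u -> g u *m shape u = 2^-1 *: g^`() u.
Proof. by move=> Uu; rewrite -scalemxAr mulKVmx ?g_unit. Qed.

Lemma shapeT_g u : U u -> (shape u)^T *m g u = 2^-1 *: g^`() u.
Proof.
by move=> Uu; rewrite -{1}(g_sym Uu) -trmx_mul g_shape // linearZ /= dg_sym.
Qed.

Lemma smooth_genA l : smooth_curve U (gen l).
Proof. exact: smooth_gen U_open g_smooth g_unit l. Qed.

Lemma subr_half (C : 'M[R]_n) : C - 2^-1 *: C = 2^-1 *: C.
Proof.
rewrite -{1}[C]scale1r -scalerBl; congr (_ *: _).
by field.
Qed.

(** Since g E_1 = g''/2 - g' g^-1 g' / 4, symmetry is visible. It is needed because the curvature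
    component (oo, i, j, oo) comes out as the entry (j, i) of g E_1. *)
Lemma g_gen1_sym u : U u -> (g u *m gen 1 u)^T = g u *m gen 1 u.
Proof.
move=> Uu.
have E : g^`() u *m shape u + g u *m shape^`() u = 2^-1 *: g^`()^`() u.
  rewrite -(derive1_val (is_deriveZ 2^-1
    (smooth_is_derive (smooth_derive1 g_smooth) Uu))).
  rewrite -[RHS](derive1_eq_on U_open g_shape Uu).
  by rewrite (derive1_val (is_derive_mulmx (smooth_is_derive g_smooth Uu)
    (smooth_is_derive (smooth_genA 0) Uu))).
have -> : g u *m gen 1 u = 2^-1 *: g^`()^`() u - 2^-1 *: (g^`() u *m shape u).
  rewrite -E [g u *m (_ + _)]mulmxDr mulmxA g_shape // -scalemxAl.
  set a := g^`() u *m shape u; set b := g u *m _.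
  by rewrite addrAC subr_half addrC.
rewrite !linearB !linearZ /= ddg_sym // trmx_mul dg_sym //.
by rewrite trmx_mul trmx_inv g_sym // dg_sym // mulmxA.
Qed.

(** Let E = E_(l+1). Then (g E)' = 2 g B E + g E', while the correction terms are B^T g E = g B E
    and g E B. The difference is g (E' + B E - E B), which is the recursion of [gen]. After l
    derivatives the tensor is Omega_(l+1). *)
Lemma iter_covariant_derivative l u i j : U u ->
  iter l (covariant_derivative G) (riemann_tensor G)
    (nseq l oo ++ [:: oo; xx i; xx j; oo]) (amb_point 0 x u)
  = (g u *m gen l.+1 u) i j.
Proof.
elim: l u i j => [|l IH] u i j Uu.
  rewrite /= (riemann_oxxo A_sym A_unit good_near) // -(g_gen1_sym Uu) mxE [RHS]mxE -shapeA_gen1 //.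
  by apply: eq_bigr => k _; rewrite !mxE.
have H := covariant_derivative_oo A_sym A_unit good_near
  (iter l (covariant_derivative G) (riemann_tensor G)) l 0 i j Uu.
cbv beta zeta in H; apply: (eq_trans H) => {H}.
rewrite (@derive1_eq_on _ _ U_open _ _ (fun u => (g u *m gen l.+1 u) i j)) //; last first.
  by move=> t Ut; apply: IH.
have /is_derive_mxP/(_ i j)/derive1_val -> := is_derive_mulmx
  (smooth_is_derive g_smooth Uu) (smooth_is_derive (smooth_genA l.+1) Uu).
transitivity ((g^`() u *m gen l.+1 u + g u *m (gen l.+1)^`() u
  - ((shape u)^T *m (g u *m gen l.+1 u) + g u *m gen l.+1 u *m shape u)) i j).
  rewrite [RHS]mxE [X in _ = _ + X]mxE [X in _ = _ + - X]mxE; congr (_ - (_ + _)).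
    by rewrite [RHS]mxE; apply: eq_bigr => k _; rewrite IH // shapeAE // [X in _ = X * _]mxE.
  by rewrite [RHS]mxE; apply: eq_bigr => k _; rewrite IH // shapeAE // mulrC.
suff -> : g u *m gen l.+2 u = g^`() u *m gen l.+1 u + g u *m (gen l.+1)^`() u
  - ((shape u)^T *m (g u *m gen l.+1 u) + g u *m gen l.+1 u *m shape u) by [].
have -> : gen l.+2 u = (gen l.+1)^`() u +
  (shape u *m gen l.+1 u + -1 *: (gen l.+1 u *m shape u)) by exact: genSS.
move: (gen l.+1 u) ((gen l.+1)^`() u) => c dc.
rewrite mulmxDr mulmxDr mulmxA g_shape // mulmxA shapeT_g // scaleN1r mulmxN mulmxA.
rewrite -scalemxAl; set a := g^`() u *m c; set b := g u *m dc.
by rewrite [in RHS]opprD [RHS]addrA [in RHS](addrAC a b) subr_half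
  [in RHS](addrC _ b) -[RHS]addrA.
Qed.

End AmbientEquations.

(** * Universal combinations *)

Section UniversalCombinations.
Variables (R : realType) (n : nat).

(** The argument [g] is the inverse metric; the value is a covariant tensor, whose index is raised
    by a further factor [g]. *)
Definition word_value (g P : 'M[R]_n) (Om : nat -> 'M[R]_n) (e : exp R) :=
  eval (fun X Z => X *m g *m Z) (fun l => if l is 0 then P else Om l) e.

(* The (k + 1)-st derivatives at u = 0 of phi ([phi_jet k]) and of
   f = log (det g)^(1/2) - phi ([logvol_jet k]); [trace_jet k] and [vol_jet k] are
   tr g^-1 g^(k+1) / 2 - phi^(k+1) and the Taylor coefficient v_(k+1). *)
Definition phi_jet k g Y P Om : R :=
  if k is j.+1 then \tr (g *m word_value g P Om (iter j (der (dgen R)) (Var R 1)))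
  else -1 * Y.

Definition logvol_jet k g Y P Om : R :=
  if k is j.+1 then -1 * \tr (g *m word_value g P Om (iter j (der (dgen R)) (shape_sq R)))
  else \tr (g *m P) + Y.

Definition trace_jet k g Y P Om : R :=
  if k is j.+1 then
    \tr (g *m word_value g P Om (half_metric_exp R j)) + logvol_jet j.+1 g Y P Om
  else \tr (g *m P) + Y.

Definition vol_jet k g Y P Om : R :=
  (k.+1`!%:R)^-1 *
    @eval R R^o *%R (fun l => logvol_jet l g Y P Om) (vol_exp R k).

Lemma scalar_invariant_word K e : (level e <= K)%N ->
  scalar_invariant K (fun g Y P Om => \tr (g *m word_value g P Om e)).
Proof. by move=> eK; apply: scalar_invariant_trace; apply: tensor_invariant_eval. Qed.

Lemma phi_jet_invariant k : scalar_invariant k (phi_jet k).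
Proof.
case: k => [|j]; first exact/scalar_invariantZ/scalar_invariantY.
apply: scalar_invariant_word; rewrite -add1n.
exact: (level_iter_der (Var R 1) j (@level_dgen R)).
Qed.

(** The index k stands for a derivative of order k + 1, so the bound is two below the order. For k =
    0 the truncated predecessor is 0, and only P and Y occur. *)
Lemma logvol_jet_invariant k : scalar_invariant k.-1 (logvol_jet k).
Proof.
case: k => [|j].
  apply: scalar_invariantD; last exact: scalar_invariantY.
  exact: (scalar_invariant_word (e := Var R 0)).
apply: scalar_invariantZ; apply: scalar_invariant_word.
exact: (level_iter_der (shape_sq R) j (@level_dgen R)).
Qed.

Lemma trace_jet_invariant k : scalar_invariant k.-1 (trace_jet k).
Proof.
case: k => [|j]; first exact: (logvol_jet_invariant 0).
apply: scalar_invariantD; last exact: (logvol_jet_invariant j.+1).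
exact/scalar_invariant_word/level_half_metric_exp.
Qed.

Lemma scalar_invariant_eval K e (x : nat -> 'M[R]_n -> R -> 'M[R]_n -> (nat -> 'M[R]_n) -> R) :
  (forall l, (l <= level e)%N -> scalar_invariant K (x l)) ->
  scalar_invariant K (fun g Y P Om => @eval R R^o *%R (fun l => x l g Y P Om) e).
Proof.
elim: e => /= [l|a IHa b IHb|c a IHa|a IHa b IHb] xK.
- exact: xK.
- apply: scalar_invariantD; [apply: IHa|apply: IHb] => l le; apply: xK;
    by rewrite leq_max le ?orbT.
- exact/scalar_invariantZ/IHa.
- apply: scalar_invariantM; [apply: IHa|apply: IHb] => l le; apply: xK;
    by rewrite leq_max le ?orbT.
Qed.

Lemma vol_jet_invariant k : scalar_invariant k.-1 (vol_jet k).
Proof.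
apply: scalar_invariantZ; apply: scalar_invariant_eval => l le.
apply: scalar_invariant_le (logvol_jet_invariant l).
have := leq_trans le (level_vol_exp R k); case: l {le} => [//|l] /=.
by case: k.
Qed.

Lemma word_valueE (g : R -> 'M[R]_n) P Om e : g 0 \in unitmx ->
  P = g 0 *m gen g 0 0 -> (forall l, Om l.+1 = g 0 *m gen g l.+1 0) ->
  invmx (g 0) *m word_value (invmx (g 0)) P Om e = eval_gen g e 0.
Proof.
move=> ug PE OmE; rewrite /word_value eval_mulmxl /eval_gen; congr (eval _ _ _).
by apply/funext => -[|l]; rewrite ?PE ?OmE mulKmx.
Qed.

(** Iterated partial derivatives in the last coordinate alone restrict, on the line over x, to the
    derivatives of the curve. *)
Lemma smooth_on_line (D : set 'rV[R]_(n + 1)) F (x : 'rV[R]_n) : smooth_on D F ->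
  smooth_curve [set u | D (row_mx x u%:M)] (fun u => F (row_mx x u%:M)).
Proof.
move=> sF; pose o : 'I_(n + 1) := rshift n ord0.
have shift t u : t *: delta_mx 0 o + row_mx x u%:M = row_mx x (t + u)%:M.
  apply/rowP => i; rewrite !mxE eqxx /=; case: (split_ordP i) => j ->.
    by rewrite eq_lrshift mulr0 add0r.
  by rewrite ord1 !mxE !eqxx !mulr1n mulr1.
have E k u : iter_partial (nseq k o) F (row_mx x u%:M)
    = (fun u => F (row_mx x u%:M))^`(k) u.
  elim: k u => [//|k IH] u /=; apply: partial_line => t.
  by rewrite shift IH.
apply: smooth_curveP => k u Du; have [_ /(_ o)] := sF _ Du (nseq k o).
by apply: derivable_line => t; rewrite shift E.
Qed.

End UniversalCombinations.

(** * Locality of the weighted tensors *)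

Section LocalityPhi.
Variables (R : realType) (m : nat) (D : set 'rV[R]_m).
Hypothesis D_open : open D.
Implicit Types (G H : 'rV[R]_m -> 'M[R]_m) (f : 'rV[R]_m -> R).

Lemma ricci_eq_on G H j l x : (forall y, D y -> G y = H y) -> D x ->
  ricci G j l x = ricci H j l x.
Proof.
move=> GH Dx; have Gx := GH x Dx; have E := curvature_op_eq_on D_open _ _ _ _ GH Dx.
rewrite /ricci /riemann Gx; apply: eq_bigr => i _; apply: eq_bigr => k _.
by under eq_bigr => p _ do rewrite E.
Qed.

(** Locality matters because g_0 and g have the same components only at points of the image of the
    chart. *)
Lemma P_phi_eq_on G H f lam i j x : (forall y, D y -> G y = H y) -> D x ->
  P_phi G f lam i j x = P_phi H f lam i j x.
Proof.
move=> GH Dx; have Gx := GH x Dx; have E := christoffel_eq_on D_open _ _ _ GH Dx.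
rewrite /P_phi /hessian (ricci_eq_on _ _ GH Dx) Gx.
by under eq_bigr => k _ do rewrite E.
Qed.

Lemma Y_phi_eq_on G H f lam x : (forall y, D y -> G y = H y) -> D x ->
  Y_phi G f lam x = Y_phi H f lam x.
Proof.
move=> GH Dx; have Gx := GH x Dx; have E i j := ricci_eq_on i j GH Dx.
rewrite /Y_phi /scalar_curvature /grad_sqnorm Gx.
by under eq_bigr => i _ do under eq_bigr => j _ do rewrite E.
Qed.

End LocalityPhi.

(** * From the ambient structure to curves of matrices *)

Section AmbientChart.
Variables (R : realType) (n : nat) (M : manifold R n).
Variables (g : tensor2 M) (phi : M -> R) (lam : R).
Variables (gu : R -> tensor2 M) (phiu : R -> M -> R).
Hypothesis ambient : normal_weighted_ambient g phi lam gu phiu.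
Variables (c : @chart R n M) (x : 'rV[R]_n).
Hypotheses (Mc : atlas M c) (cx : img c x).

Let gx u := gu u c x.
Let phix u := phiu u (of_coord c x).
Let P : 'M[R]_n := \matrix_(i, j) P_phi (g c) (fun y => phi (of_coord c y)) lam i j x.
Let Y := Y_phi (g c) (fun y => phi (of_coord c y)) lam x.

Lemma ambient_curve : exists U : set R,
  [/\ [/\ open U, U 0, smooth_curve U gx, smooth_curve U phix
        & forall u, U u -> gx u \in unitmx],
      [/\ gx 0 = g c x, (gx 0)^T = gx 0 & phiu 0 = phi],
      P = gx 0 *m gen gx 0 0 /\ (forall l, Omega_phi gu c l.+1 x = gx 0 *m gen gx l.+1 0),
      phix^`() 0 = - Y
    & forall j, (fun u => phix^`(2) u + -1 *: \tr (gen gx 1 u))^`(j) 0 = 0].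
Proof.
have [W [[W_open W0] gu_metric gu_smooth [gu0 phiu0] amb]] := ambient.
pose A u y := gu u c y.
pose ps u y := phiu u (of_coord c y).
pose good y u := img c y /\ W (of_coord c y, u).
have A_sym y u : good y u -> (A u y)^T = A u y.
  by move=> [cy Wy]; have [] := gu_metric u c Mc y cy Wy.
have A_unit y u : good y u -> A u y \in unitmx.
  by move=> [cy Wy]; have [] := gu_metric u c Mc y cy Wy.
have good_near v y u : good y u ->
    \forall z \near amb_point v y u, good (amb_x z) (amb_u z).
  move=> [cy Wy].
  have cont_x : {for amb_point v y u, continuous (@amb_x R n)}.
    apply: continuous_comp; first exact: continuous_rsubmx.
    exact: continuous_lsubmx.
  have cont_u : {for amb_point v y u, continuous (@amb_u R n)}.
    have -> : @amb_u R n = fun z => z 0 (idx_oo n).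
      by apply/funext => z; rewrite /amb_u !mxE.
    exact: coord_continuous.
  have near_img : \forall z \near amb_point v y u, img c (amb_x z).
    apply: cont_x; rewrite /= amb_x_point.
    by apply: open_nbhs_nbhs; split=> //; apply: img_open.
  have near_W : \forall z \near amb_point v y u, W (of_coord c (amb_x z), amb_u z).
    have cont_c : {for amb_point v y u, continuous (of_coord c \o @amb_x R n)}.
      apply: continuous_comp => //; rewrite amb_x_point.
      exact: of_coord_continuous.
    have nW : nbhs (of_coord c y, u) W by apply: open_nbhs_nbhs.
    have := cvg_pair cont_c cont_u; rewrite /= amb_x_point amb_u_point => cont.
    exact: cont _ nW.
  by near=> z; split; near: z.
have U_open : open (good x).
  rewrite openE => u gxu; rewrite /interior.
  have cont : (fun t => (of_coord c x, t)) @ u --> (of_coord c x, u).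
    exact: (cvg_pair (cvg_cst _) cvg_id).
  have near_W : \forall t \near u, W (of_coord c x, t).
    have nW : nbhs (of_coord c x, u) W by apply: open_nbhs_nbhs; split=> //; exact: gxu.2.
    exact: cont _ nW.
  by apply: filterS near_W => t Wt; split.
have U0 : good x 0 by split.
have [sA sps] := gu_smooth c Mc.
have rowl u : lsubmx (row_mx x (u%:M : 'M[R]_1)) = x by rewrite row_mxKl.
have rowr u : rsubmx (row_mx x (u%:M : 'M[R]_1)) 0 0 = u.
  by rewrite row_mxKr mxE eqxx mulr1n.
set D := (X in forall i j, smooth_on X _) in sA.
have DE : [set u | D (row_mx x u%:M)] = good x.
  by apply/funext => u; rewrite /D /= rowl rowr.
have g_smooth : smooth_curve (good x) (A^~ x).
  apply/(smooth_mxP _ U_open) => i j; have := smooth_on_line x (sA i j).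
  by rewrite DE; under eq_fun do rewrite rowl rowr.
have phi_smooth : smooth_curve (good x) (ps^~ x).
  have := smooth_on_line x sps.
  by rewrite DE; under eq_fun do rewrite rowl rowr.
have [ambP ambF] : (forall a b, O_u_infty (P_phi (amb_metric gu c)
     (amb_phi lam phiu c) lam a b) (amb_point 0 x 0)) /\
   O_u_infty (F_phi (amb_metric gu c) (amb_phi lam phiu c) lam) (amb_point 0 x 0).
  exact: amb.
have phiE : phiu 0 = phi by apply/funext.
have psE : ps 0 = fun y => phi (of_coord c y).
  by apply/funext => y; rewrite /ps phiE.
have A0 y : img c y -> A 0 y = g c y by exact: gu0.
have PE : P = 2^-1 *: (A^~ x)^`() 0.
  apply: eq_trans (@metric_derive0 R n A good A_unit good_near ps lam x U0 g_smooth
    (fun i j => ambP (idx_x i) (idx_x j))).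
  apply/matrixP => i j; rewrite !mxE psE.
  by rewrite (P_phi_eq_on (@img_open R n M c) _ _ _ _ A0).
exists (good x); split; first by split=> // u; apply: A_unit.
- by split=> //; [apply: A0|apply: A_sym].
- split.
    by rewrite PE /gen /shape -scalemxAr mulKVmx // A_unit.
  move=> l; apply/matrixP => i j; rewrite mxE.
  by have := iter_covariant_derivative A_sym A_unit good_near U_open g_smooth l i j U0.
- rewrite /Y -(Y_phi_eq_on (@img_open R n M c) _ _ A0) // -psE.
  exact: (@phi_derive0 R n A good A_sym A_unit good_near ps lam x U0 g_smooth phi_smooth
    (fun i j => ambP (idx_x i) (idx_x j)) ambF).
- exact: (@phi_flat R n A good A_sym A_unit good_near ps lam x U_open U0 g_smooth phi_smooth
    (ambP _ _)).
Unshelve. all: by end_near. Qed.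

End AmbientChart.

Theorem theorem1p13 (R : realType) (n k : nat) (hk : (0 < k)%N) :
  exists (Q : lin_comb R 2) (S T V : lin_comb R 0),
    [/\ lin_comb_in false (k - 1) Q, lin_comb_in true (k - 1) S,
        lin_comb_in true (k - 2) T & lin_comb_in true (k - 2) V] /\
    forall (M : manifold R n) (g : tensor2 M) (phi : M -> R) (lam : R)
      (gu : R -> tensor2 M) (phiu : R -> M -> R),
    pseudo_riemannian g -> smooth_function phi ->
    normal_weighted_ambient g phi lam gu phiu ->
    forall (c : chart n M) (x : 'rV[R]_n), atlas M c -> img c x ->
    let dg i j := derive1n k (fun u => gu u c x i j) 0 in
    let dphi := derive1n k (fun u => phiu u (of_coord c x)) 0 in
    [/\ forall i j : 'I_n, dg i j = lin_comb_at g phi lam gu c x Q [tuple i; j],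
        dphi = lin_comb_at g phi lam gu c x S [tuple],
        2^-1 * (\sum_i \sum_j invmx (g c x) i j * dg i j) - dphi
          = lin_comb_at g phi lam gu c x T [tuple]
      & v_coef g phi lam gu phiu k c x = lin_comb_at g phi lam gu c x V [tuple]].
Proof.
(* From here on [k] is one less than the order of differentiation, so the bounds k - 1 and k - 2
   become k and its truncated predecessor. *)
case: k hk => // k _.
have [Q Qin QE] := tensor_invariant_eval n (level_metric_exp R k).
have [S Sin SE] := @phi_jet_invariant R n k.
have [T Tin TE] := @trace_jet_invariant R n k.
have [V Vin VE] := @vol_jet_invariant R n k.
exists Q, S, T, V; split; first by rewrite subSS subn0 subSS subn1; split.
move=> M g phi lam gu phiu _ _ ambient c x Mc cx dg dphi.
have [U [[oU U0 sg sphi ug] [g0 g0T phi0] [PE OmE] dphi0 flat]] :=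
  ambient_curve ambient Mc cx.
rewrite /lin_comb_at.
set Y := Y_phi _ _ _ _; set P := \matrix_(i, j) _; set Om := fun l => Omega_phi _ _ _ _.
rewrite -/Y -/P in PE dphi0.
set gx := fun u => gu u c x in sg ug g0 g0T PE OmE flat.
set phix := fun u => phiu u (of_coord c x) in sphi dphi0 flat.
have W e : invmx (g c x) *m word_value (invmx (g c x)) P Om e = eval_gen gx e 0.
  by rewrite -g0; apply: word_valueE => //; apply: ug.
have dgE i j : dg i j = gx^`(k.+1) 0 i j by rewrite -(derive1n_mx _ _ _ oU sg U0).
have ginvP : \tr (invmx (g c x) *m P) = \tr (gen gx 0 0).
  by rewrite PE -g0 mulKmx // ug.
have logvolE j : logvol_jet j (invmx (g c x)) Y P Om = (logvol' gx phix)^`(j) 0.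
  case: j => [|j]; first by rewrite /logvol_jet ginvP derive1n0 /logvol' dphi0 scaleN1r opprK.
  by rewrite (derive1n_logvol' oU U0 sg ug sphi flat) /logvol_jet W mulN1r.
split.
(* Since g^(k+1) = g q_k and q_k is g^-1 times the value of the word on covariant tensors, the
   factor g cancels g^-1. *)
- move=> i j; rewrite QE dgE (derive1n_metric oU sg ug _ U0) -W -g0.
  by rewrite mulKVmx // ug.
(* Order 1 is the equation phi' = - Y; higher orders come from the jet of tr E_1. *)
- rewrite SE; case: k {Q S T V Qin Sin Tin Vin QE SE TE VE dgE} @dg @dphi => [|j] /=.
    by rewrite mulN1r -dphi0.
  by rewrite W -(derive1n_phi oU U0 sg ug sphi flat).
- have -> : 2^-1 * (\sum_i \sum_j invmx (g c x) i j * dg i j)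
      = 2^-1 * \tr (invmx (gx 0) *m gx^`(k.+1) 0).
    (* The full contraction pairs equal positions, while the trace of a product pairs them
       crosswise; the symmetry of the inverse metric reconciles the two. *)
    congr (_ * _); rewrite exchange_big /=; apply: eq_bigr => j _; rewrite mxE.
    apply: eq_bigr => i _; rewrite dgE -g0; congr (_ * _).
    by rewrite -{1}g0T -trmx_inv mxE.
  rewrite TE; case: k {Q S T V Qin Sin Tin Vin QE SE TE VE dgE} @dg @dphi => [|j] /=.
    by rewrite ginvP -[X in _ - X = _]/(phix^`() 0) dphi0 opprK /gen /shape linearZ.
  rewrite (trace_metric_phi oU U0 sg ug sphi flat) /trace_jet W /logvol_jet W.
  by rewrite mulN1r.
- rewrite VE /v_coef /vol_jet; congr (_ * _).
  (* On v = 0 both terms of the ambient potential that contain v vanish, and the ambient density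
     becomes [vol]. *)
  have -> : (fun u => v_phi g phi lam gu phiu c (amb_point 0 x u)) = vol gx phix.
    apply/funext => u; rewrite /v_phi /vol /amb_phi amb_u_point amb_x_point amb_v_point.
    by rewrite subr0 mulr0 addr0 /gx /phix phi0 -g0.
  rewrite (derive1n_vol0 oU U0 sg ug sphi) /eval_logvol; congr (eval _ _ _).
  by apply/funext => l; rewrite logvolE.
Qed.
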